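(* Let $T$ and $T'$ be well-placed tangles in decorated surfaces $S$ and $S'$ respectively, such that the lower boundary of $S$ (an ordered set of boundary components) matches the upper boundary of $S'$. Then the evaluation of the composite tangle $T'\circ T$ is the matrix product $$[T'\circ T]=[T']\,[T].$$
   Context: Everything is piecewise linear. A surface $S$ is a compact oriented surface, possibly with boundary $\partial S$; the components of $\partial S$ are called holes. A tangle $T$ in $S$ is a finite set of unoriented curves in $S$ meeting transversally, with under/over information at each crossing, where each non-closed curve has its endpoints on $\partial S$ and $T$ is otherwise disjoint from $\partial S$ (considered up to isotopy). A face is a connected component $f$ of $S\setminus T$; $\partial f$ is its boundary in $S$, and $\chi_f=2-2g_f-c_f$ is its Euler characteristic ($g_f$ the genus, $c_f$ the number of boundary components). $T$ is well-placed if for every face $f$ the set $\partial f\cap\partial S$ is connected. Decoration: two disjoint, possibly empty, ordered sets of holes of $S$ are chosen, the upper boundary and the lower boundary, and on each hole a starting point avoiding $T$ is marked, so that the endpoints of $T$ on each hole are linearly ordered. The lower boundary of $S$ matches the upper boundary of $S'$ if the ordered lists of holes have the same length and corresponding holes have anti-isomorphic linearly ordered sets of tangle endpoints. Then $T'\circ T$ is the tangle obtained by pasting $S$ and $S'$ along corresponding holes, aligned via marked points, and fusing corresponding strands; its upper boundary is that of $S$ and its lower boundary is that of $S'$. Evaluation: fix a finite set of symbols, a commutative ring $\mathcal R$ contained in an overring $\mathcal R^{\sqrt{}}$, invertible elements $x_i\in\mathcal R$ (one per symbol) with chosen square roots $\sqrt{x_i}\in\mathcal R^{\sqrt{}}$,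 a list of forbidden unordered pairs $\{i,j\}$ of symbols ($i=j$ allowed), and elements $x_{ijkl}\in\mathcal R$ with $x_{klij}=x_{ijkl}$, set to zero when they involve a forbidden pair of adjacent symbols. A state of $T$ assigns a symbol to each face; it is forbidden (value $0$) if two faces adjacent along an edge carry a forbidden pair. The value of a non-forbidden state is the product of the following: for each face $f$ with symbol $i$, the factor $x_i^{\chi_f}$, divided by $\sqrt{x_i}$ if $\partial f$ contains part but not all of some hole (that is, $f$ meets $\partial S$ in an arc delimited by endpoints of $T$); for each crossing, the factor $x_{ijkl}$, where, viewing the crossing so that the overpass is the northeast-southwest strand, $i,j,k,l$ are the symbols of the adjacent faces in anticlockwise order starting from the east. $\Upsilon(T)$ (resp. $\Lambda(T)$) is the canonically ordered list of all partial states assigning symbols exactly to the faces meeting the upper (resp. lower) boundary, excluding inconsistent or forbidden ones. (By well-placedness no face meets both boundaries, and such partial states amount to assignments of symbols to the components of the upper, resp. lower, holes minus $T$; via the matching, $\Lambda(T)$ and $\Upsilon(T')$ are identified in this way, entries for omitted forbidden assignments being regarded as zero.) An empty boundary gives a list with one (empty) element. The evaluation $[T]$ is the matrix over $\mathcal R^{\sqrt{}}$ whose $(\lambda,\upsilon)$-entry, for $(\lambda,\upsilon)\in\Lambda(T)\times\Upsilon(T)$, is the sum of the values of all states of $T$ extending both $\lambda$ and $\upsilon$. *)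

(* Defs.v *)
From HB Require Import structures.
From mathcomp Require Import all_boot all_order all_algebra.

Set Implicit Arguments.
Unset Strict Implicit.
Unset Printing Implicit Defensive.

Import GRing.Theory.
Local Open Scope ring_scope.

(* A compact oriented PL surface is presented as finitely many oriented
   polygons with some of their sides glued in pairs, reversing orientation.
   [nxt] is the next side anticlockwise around the polygon (the polygon lies
   to the left of its sides); [opp] exchanges glued sides and fixes the unglued
   ones, which form the boundary and are thus oriented as the boundary of S.
   A side is also used to denote the corner of its polygon at its origin. *)
Record surface := Surface {
  side : finType;
  nxt : side -> side;
  opp : side -> side
}.

Section Surface.
Variable X : surface.
Implicit Types d b : side X.

Definition is_surface := injective (@nxt X) /\ involutive (@opp X).

Definition bdry : pred (side X) := fun d => opp d == d.

(* The head of a glued side e is the origin both of nxt e and of opp e. *)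
Definition corner_rel : rel (side X) :=
  fun d d' => [exists e, ~~ bdry e && ([set d; d'] == [set nxt e; opp e])].
Definition same_vertex : rel (side X) := connect corner_rel.
Definition vertex d : {set side X} := [set d' | same_vertex d d'].

Definition piece_rel : rel (side X) :=
  fun d d' => [|| d' == nxt d, d == nxt d' | d' == opp d].
Definition component d : {set side X} := [set d' | connect piece_rel d d'].

(* vertices - edges + polygons, for A a union of components *)
Definition euler (A : {set side X}) : int :=
  (n_comp corner_rel A)%:Z - (fcard (@opp X) A)%:Z + (fcard (@nxt X) A)%:Z.

(* The boundary side starting where the boundary side b ends. *)
Definition bnext b : side X :=
  odflt b [pick b' | [&& bdry b, bdry b' & same_vertex (nxt b) b']].

(* The sides of the hole of the boundary side b, starting from b. *)
Definition hole b : seq (side X) := orbit bnext b.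

End Surface.

(* A tangle in a decorated surface: the polygons are chosen so that the tangle
   is a union of edges. Among the two sides at an edge end, the one leaving that
   end represents the branch of the tangle there, so a branch at a vertex is a
   side in [strand] issuing from it; [over] selects the branches of the overpass
   at crossings and is irrelevant elsewhere. A decorated hole is represented by
   the boundary side that contains its starting point. *)
Record diagram := Diagram {
  surf :> surface;
  strand : pred (side surf);
  over : pred (side surf);
  upper : seq (side surf);
  lower : seq (side surf)
}.

Section Diagram.
Variable T : diagram.
Implicit Types d b t : side T.

(* S cut along T; its components are the (compactified) faces of T. *)
Definition cut : surface :=
  @Surface (side T) (@nxt T) (fun d => if strand d then d else opp d).

Definition degree d : nat := #|[set t in vertex d | strand t]|.

(* t' is the branch following t anticlockwise around their common vertex: the
   corner just before t' lies in the same sector of the cut surface as t. *)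
Definition follows t t' : bool := same_vertex (X := cut) t (nxt (opp t')).

(* Number of endpoints of T on the hole of b. *)
Definition endpoints b : nat := count (fun c => degree c == 1%N) (hole b).

Record is_tangle : Prop := IsTangle {
  tangle_surface : is_surface T;
  strand_opp : forall d, strand d -> strand (opp d);
  strand_interior : forall d, strand d -> ~~ bdry d;
  (* The boundary is subdivided minimally: its vertices are the endpoints of T,
     and one vertex on each hole disjoint from T. *)
  degree_bdry : forall b, bdry b ->
    degree b = 1%N \/ degree b = 0%N /\ size (hole b) = 1%N;
  degree_interior : forall d, [forall d' in vertex d, ~~ bdry d'] ->
    degree d \in [:: 0; 2; 4]%N;
  (* Two opposite branches of a crossing form the overpass. *)
  over_crossing : forall t t', strand t -> strand t' -> degree t = 4%N ->
    follows t t' -> over t' = ~~ over t;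
  decorated_bdry : all (@bdry T) (upper T ++ lower T);
  decorated_uniq : uniq (flatten [seq hole b | b <- upper T ++ lower T])
}.

Definition faces : {set {set side T}} :=
  [set component (X := cut) d | d in [set: side T]].
Definition face := {f : {set side T} | f \in faces}.
Definition face_of d : face :=
  exist (fun f => f \in faces) (component (X := cut) d) (imset_f _ (in_setT d)).

Definition euler_face (f : face) : int := euler (X := cut) (val f).

(* As boundary vertices lie on T, or are alone on a hole disjoint from T, the
   boundary sides stand for the components of the complement of T in the holes:
   arcs delimited by endpoints of T, and entire holes. *)
Definition well_placed : bool :=
  [forall f : face, #|[set b in val f | bdry b]| <= 1]%N.

(* Whether f contains part but not all of some hole. *)
Definition meets_arc (f : face) : bool :=
  [exists b in val f, bdry b && (0 < endpoints b)%N].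

Definition crossings : {set {set side T}} :=
  [set vertex d | d in [set d | degree d == 4%N]].

(* The components of the complement of T in the upper and in the lower holes,
   from the starting points on; the lower ones are listed against the boundary
   orientation, so that matching components have the same rank. *)
Definition upper_arcs : seq (side T) := flatten [seq hole b | b <- upper T].
Definition lower_arcs : seq (side T) :=
  flatten [seq b :: rev (behead (hole b)) | b <- lower T].

End Diagram.

(* Equality of numbers of endpoints amounts to the (unique) anti-isomorphism of
   the finite linearly ordered sets of endpoints. *)
Definition matches (T T' : diagram) : Prop :=
  [seq endpoints b | b <- lower T] = [seq endpoints b | b <- upper T'].

(* partner s s' d is the element of s' of the same rank as d in s. *)
Definition partner (A B : eqType) (s : seq A) (s' : seq B) (d : A) : option B :=
  onth s' (index d s).

(* paste T T' is T' \o T. *)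
Definition paste (T T' : diagram) : diagram :=
  let D : finType := (side T + side T')%type in
  let nxt2 (d : D) : D :=
    match d with inl a => inl (nxt a) | inr a => inr (nxt a) end in
  let opp2 (d : D) : D :=
    match d with
    | inl a => if partner (lower_arcs T) (upper_arcs T') a is Some a'
               then inr a' else inl (opp a)
    | inr a => if partner (upper_arcs T') (lower_arcs T) a is Some a'
               then inl a' else inr (opp a)
    end in
  @Diagram (@Surface D nxt2 opp2)
    (fun d : D => match d with inl a => strand a | inr a => strand a end)
    (fun d : D => match d with inl a => over a | inr a => over a end)
    [seq inl b | b <- upper T] [seq inr b | b <- lower T'].

Record weights (R Rs : comUnitRingType) := Weights {
  sym : finType;
  iota : {rmorphism R -> Rs};
  iota_inj : injective iota;
  wt : sym -> R;
  wt_unit : forall i, wt i \is a GRing.unit;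
  sqrt_wt : sym -> Rs;
  sqrt_wtK : forall i, sqrt_wt i ^+ 2 = iota (wt i);
  forbidden : rel sym;
  forbidden_sym : symmetric forbidden;
  cwt : sym -> sym -> sym -> sym -> R;
  cwt_rot : forall i j k l, cwt k l i j = cwt i j k l;
  cwt_forbidden : forall i j k l,
    [|| forbidden i j, forbidden j k, forbidden k l | forbidden l i] ->
    cwt i j k l = 0
}.

(* Matrices with rows and columns indexed by lists, here of words. *)
Record indexed_mx (R : Type) (I : Type) := IndexedMx {
  rows : seq I;
  cols : seq I;
  entries : 'M[R]_(size rows, size cols)
}.

Section IndexedMx.
Variables (R : pzSemiRingType) (I : eqType).
Implicit Types A B : indexed_mx R I.

(* The (r, c) entry, or zero if r or c is not an index of A. *)
Definition entry A (r c : I) : R :=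
  match insub (index r (rows A)), insub (index c (cols A)) with
  | Some i, Some j => entries A i j
  | _, _ => 0
  end.

Definition submx_at A (rs cs : seq I) : 'M[R]_(size rs, size cs) :=
  \matrix_(i, j) entry A (tnth (in_tuple rs) i) (tnth (in_tuple cs) j).

(* The product over all column indices of A and row indices of B, missing
   entries being zero. *)
Definition mul_indexed A B : indexed_mx R I :=
  let mid := undup (cols A ++ rows B) in
  IndexedMx (submx_at A (rows A) mid *m submx_at B mid (cols B)).

End IndexedMx.

Section Evaluation.
Variables (R Rs : comUnitRingType) (W : weights R Rs) (T : diagram).
Implicit Types (s : {ffun face T -> sym W}) (arcs : seq (side T)).
Implicit Types (w : seq (sym W)).

Definition forbidden_state s : bool :=
  [exists t, strand t && forbidden (s (face_of t)) (s (face_of (opp t)))].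

(* For an overpass branch t pointing northeast and the opposite branch t', the
   faces to the right and left of t, then of t', are the eastern, northern,
   western and southern ones. *)
Definition crossing_value s (V : {set side T}) : R :=
  if enum [set t in V | strand t && over t] is [:: t; t'] then
    cwt (s (face_of (opp t))) (s (face_of t))
        (s (face_of (opp t'))) (s (face_of t'))
  else 0.

Definition face_value s (f : face T) : Rs :=
  iota W (wt (s f)) ^ euler_face f /
  (if meets_arc f then sqrt_wt (s f) else 1).

Definition value s : Rs :=
  if forbidden_state s then 0 else
  (\prod_(f : face T) face_value s f) *
  \prod_(V in crossings T) iota W (crossing_value s V).

(* Partial states on the faces meeting the given boundary sides. *)
Definition partial_state arcs (p : {ffun face T -> option (sym W)}) : bool :=
  [forall f, isSome (p f) == has (fun a => a \in val f) arcs].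

Definition forbidden_partial (p : {ffun face T -> option (sym W)}) : bool :=
  [exists t, strand t &&
    (if (p (face_of t), p (face_of (opp t))) is (Some i, Some j)
     then forbidden i j else false)].

(* Whether assigning the symbols of w to the components arcs of the holes minus
   T is induced by a non-forbidden partial state. *)
Definition admissible arcs w : bool :=
  [exists p : {ffun face T -> option (sym W)},
    [&& partial_state arcs p, ~~ forbidden_partial p &
        [seq p (face_of a) | a <- arcs] == [seq Some i | i <- w]]].

(* The partial states, as words, in the order of the enumeration of tuples. *)
Definition boundary_states arcs : seq (seq (sym W)) :=
  [seq w <- [seq val u | u <- enum {: (size arcs).-tuple (sym W)}]
   | admissible arcs w].

Definition Upsilon := boundary_states (upper_arcs T).
Definition Lambda := boundary_states (lower_arcs T).

Definition extends s arcs w : bool := [seq s (face_of a) | a <- arcs] == w.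

Definition evaluation : indexed_mx Rs (seq (sym W)) :=
  @IndexedMx Rs _ Lambda Upsilon
    (\matrix_(i, j) \sum_(s | extends s (lower_arcs T) (tnth (in_tuple Lambda) i)
                           && extends s (upper_arcs T) (tnth (in_tuple Upsilon) j))
       value s).

End Evaluation.

(* Main.v *)
From mathcomp Require Import all_boot all_order all_algebra.
From mathcomp Require Import zify ring.
Require Import Defs.

Set Implicit Arguments.
Unset Strict Implicit.
Unset Printing Implicit Defensive.

Import GRing.Theory.

(** Fix the words that a state of the composite must induce on the lower and on
    the upper boundary. The faces of the composite arise from those of the two
    tangles by pasting along arcs of holes and along whole holes, so a state of
    the composite is a pair of states of the two tangles that agree along the
    pasted holes ([sum_states_pasted]). If the value of such a state is the
    product of the values of its two parts ([value_pasted]), then grouping the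
    pairs by the word that both parts induce on the pasted holes gives exactly
    the matrix product ([state_sum_pasted]). Words induced by no admissible
    partial state do no harm: every state extending one of them is forbidden and
    has value zero, so an entry of an evaluation is the plain sum over the
    states extending two given words, whatever these words are
    ([entry_evaluation]).

    Crossings and edges of the tangle lie away from the pasted holes, so the
    crossing factors and the forbidden adjacencies cause no difficulty. The
    content is in the face factors. As [sqrt_wt i] squares to the weight of i,
    the factor of a face f with symbol i is the power of [sqrt_wt i] with
    exponent 2 * chi(f), minus 1 if f meets the boundary in an arc, and the
    claim is that these exponents add up under pasting. Pasting along an arc
    lowers the total Euler characteristic by 1 and removes two arcs; pasting
    along a circle disjoint from the tangles changes neither.

    As chi counts vertices, edges and polygons of the cut surface, this is proved
    by distributing the exponent over the sides of a face. In a surface the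
    corners around a boundary vertex form a fan starting at the only boundary
    side that issues from it ([bdry_vertex_inj]). Hence the vertices of the cut
    surface are in bijection with its boundary sides, except for isolated ones, around which there is
    neither boundary nor strand. This expresses the exponent as a sum of local
    terms, [side_weight] ([euler_cut], [face_valueE]), all unaffected by pasting
    apart from one: two boundary circles disjoint from the tangles, each of
    weight 1, are replaced by one isolated vertex, of weight 2
    ([card_isolated_root_pasted]).

    Well-placedness enters twice. A face meets the boundary at most once, so the
    number of its boundary arcs is 0 or 1, as the definition of a face factor
    requires. And a face meeting an unpasted hole meets no pasted one, hence is
    still a face of the composite ([face_unglued]), so that the rows and columns
    of the two matrices are indexed by the same words
    ([boundary_states_pasted]).

    All statements about pasting concern one of the two tangles, embedded in
    the composite, and are symmetric in the two tangles ([half_pasting]). *)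

(** * Classes of relations and orbits *)

(** Connectedness as an inductive predicate, to prove invariants of classes. *)
Lemma connect_ind (D : finType) (e : rel D) (P : D -> Prop) x y :
    P x -> (forall u v, P u -> e u v -> P v) -> connect e x y -> P y.
Proof.
move=> Px Pe /connectP[p]; elim: p x Px => [|z p IHp] x Px /=; first by move=> _ ->.
by case/andP=> /(Pe _ _ Px) Pz; apply: IHp.
Qed.

(** Counting classes through any system of representatives, instead of the
    canonical roots, lets classes be recognised by a distinguished member. *)
Lemma n_comp_transversal (D : finType) (e : rel D) (A B : {set D}) :
    connect_sym e -> closed e A -> B \subset A ->
    {in B &, forall x y, connect e x y -> x = y} ->
    (forall x, x \in A -> exists2 y, y \in B & connect e x y) ->
  n_comp e A = #|B|.
Proof.
move=> eC Acl /subsetP sBA Binj Bsurj.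
have <- : #|fingraph.root e @: B| = #|B|.
  apply: card_in_imset => x y xB yB /eqP; rewrite root_connect //.
  exact: Binj.
apply: eq_card => x; rewrite !inE; apply/andP/imsetP.
  case=> /eqP rx xA; have [y yB xy] := Bsurj x xA.
  by exists y => //; rewrite -rx; apply/eqP; rewrite root_connect.
case=> y yB ->; rewrite roots_root //; split=> //.
by rewrite -(closed_connect Acl (connect_root e y)) sBA.
Qed.

(** The orbits that are not fixed points have two elements. Applied to the gluing
    of sides, this counts edges: a glued side is half an edge. *)
Lemma fcard_involutive (D : finType) (f : D -> D) (A : {set D}) :
    involutive f -> fclosed f A ->
  (2 * fcard f A = #|A| + #|[set d in A | f d == d]|)%N.
Proof.
move=> fK Acl; pose R := [set d in A | d \in roots (frel f)].
have fC : connect_sym (frel f) by apply: fconnect_sym; apply: inv_inj.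
have fcE x y : fconnect f x y = (y == x) || (y == f x).
  apply/idP/orP; last by case=> /eqP->; rewrite ?connect0 ?fconnect1.
  apply: (connect_ind (P := fun z => z == x \/ z == f x)); first by left.
  by move=> u v [] /eqP-> /eqP<-; rewrite ?fK eqxx; [right | left].
have fA x : (f x \in A) = (x \in A) by rewrite -(Acl x (f x)) /=.
have RE x : (x \in R) = (x \in A) && (froot f x == x) by rewrite !inE.
have -> : fcard f A = #|R|.
  by apply: eq_card => x; rewrite RE !inE andbC.
have <- : R :|: f @: R = A.
  apply/setP=> x; rewrite in_setU; apply/orP/idP.
    by case=> [|/imsetP[y + ->]]; rewrite RE => /andP[]; rewrite ?fA.
  move=> xA; have := connect_root (frel f) x; rewrite fcE.
  case/orP=> /eqP rx; first by left; rewrite RE xA rx eqxx.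
  right; apply/imsetP; exists (f x); rewrite ?fK // RE fA xA /=.
  by rewrite -{2}rx root_connect // fC fconnect1.
have cf : #|f @: R| = #|R| by rewrite card_imset //; apply: inv_inj.
have := cardsUI R (f @: R); rewrite cf mul2n -addnn => <-; congr (_ + _)%N.
apply: eq_card => x; rewrite in_setI inE in_setU; apply/andP/andP.
  case=> xR /imsetP[y yR xy]; rewrite xR; split=> //.
  have /eqP: froot f x == froot f y by rewrite root_connect // fC xy fconnect1.
  move: xR yR; rewrite !RE => /andP[_ /eqP->] /andP[_ /eqP->] xyE.
  by rewrite {1}xyE -xy eqxx.
case=> xA /eqP fx; suff xR : x \in R by split=> //; apply/imsetP; exists x.
by case/orP: xA => // /imsetP[y yR xy]; move: fx; rewrite xy fK => <-.
Qed.

(** * Vertices and holes of a surface *)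

Section CornerGraph.
Variable X : surface.
Implicit Types (b d e x : side X) (V : {set side X}).

Lemma corner_rel_glued e : ~~ bdry e -> corner_rel (nxt e) (opp e).
Proof. by move=> ne; apply/existsP; exists e; rewrite ne eqxx. Qed.

(** An elementary identification of corners takes place at the head of a glued
    side, in one of two directions. *)
Lemma corner_relP d d' :
    corner_rel d d' ->
  exists2 e, ~~ bdry e & (d = nxt e /\ d' = opp e) \/ (d = opp e /\ d' = nxt e).
Proof.
case/existsP=> e /andP[ne /eqP E]; exists e => //.
have: nxt e \in [set d; d'] by rewrite E set21.
have: opp e \in [set d; d'] by rewrite E set22.
have: d \in [set nxt e; opp e] by rewrite -E set21.
have: d' \in [set nxt e; opp e] by rewrite -E set22.
rewrite !in_set2 => /orP[]/eqP-> /orP[]/eqP->; rewrite ?eqxx; try by [left|right].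
  by rewrite orbb => /eqP->; left.
by move=> _ /orP[]/eqP->; left.
Qed.

Lemma corner_rel_sym : symmetric (@corner_rel X).
Proof. by move=> d d'; rewrite /corner_rel; under eq_existsb do rewrite setUC. Qed.

Lemma same_vertexC : connect_sym (@corner_rel X).
Proof. exact/sym_connect_sym/corner_rel_sym. Qed.

Lemma same_vertex_sym d d' : same_vertex d d' = same_vertex d' d.
Proof. exact: same_vertexC. Qed.

Lemma same_vertex_refl d : same_vertex d d.
Proof. exact: connect0. Qed.

Lemma same_vertex_trans : transitive (@same_vertex X).
Proof. exact: connect_trans. Qed.

Lemma same_vertex_glued e : ~~ bdry e -> same_vertex (nxt e) (opp e).
Proof. by move=> ne; apply/connect1/corner_rel_glued. Qed.

Lemma in_vertex d d' : (d' \in vertex d) = same_vertex d d'.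
Proof. by rewrite inE. Qed.

Lemma vertex_refl d : d \in vertex d.
Proof. by rewrite in_vertex same_vertex_refl. Qed.

Lemma vertexE d d' : same_vertex d d' -> vertex d = vertex d'.
Proof.
move=> dd'; apply/setP=> x; rewrite !in_vertex.
exact: (same_connect same_vertexC).
Qed.

Lemma vertex_closed V :
    (forall e, ~~ bdry e -> (nxt e \in V) = (opp e \in V)) ->
  forall d d', same_vertex d d' -> (d \in V) = (d' \in V).
Proof.
move=> Vcl d d'.
apply: (connect_ind (P := fun z => (d \in V) = (z \in V))) => // u v -> .
by case/corner_relP=> e /Vcl E [] [-> ->]; rewrite E.
Qed.

Lemma vertex_sub V d :
    (forall e, ~~ bdry e -> (nxt e \in V) = (opp e \in V)) ->
  d \in V -> vertex d \subset V.
Proof.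
move=> Vcl dV; apply/subsetP=> x; rewrite in_vertex => dx.
by rewrite -(vertex_closed Vcl dx).
Qed.

End CornerGraph.

Section Surface.
Variable X : surface.
Hypothesis X_surface : is_surface X.
Implicit Types b d e x : side X.

Let nxt_inj : injective (@nxt X) := X_surface.1.
Let oppK : involutive (@opp X) := X_surface.2.
Let opp_inj : injective (@opp X) := inv_inj oppK.

Lemma bdry_opp d : bdry (opp d) = bdry d.
Proof. by rewrite /bdry oppK eq_sym. Qed.

(* Turning anticlockwise around the origin of d; on leaving the surface through
   a boundary side, this function jumps to that side. *)
Let turn d := opp (finv (@nxt X) d).

Let turn_nxt e : turn (nxt e) = opp e.
Proof. by rewrite /turn finv_f. Qed.

Let turn_inj : injective turn.
Proof. by move=> d d' /opp_inj /(can_inj (f_finv nxt_inj)). Qed.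

(* A vertex on the boundary is a fan of corners, read anticlockwise from its
   boundary side. *)
Let fan b d := exists k, d = iter k turn b /\
  forall i, (i < k)%N -> ~~ bdry (finv (@nxt X) (iter i turn b)).

Let fan_same_vertex b d : bdry b -> same_vertex b d -> fan b d.
Proof.
move=> bb; apply: connect_ind; first by exists 0%N.
move=> u v [k [-> fk]] /corner_relP[e ne [] [Eu ->]].
  exists k.+1; rewrite iterS Eu turn_nxt; split=> // i; rewrite ltnS leq_eqVlt.
  by case/orP=> [/eqP-> | /fk //]; rewrite Eu finv_f.
case: k fk Eu => [|k] fk Eu.
  by move: ne; rewrite -bdry_opp -Eu bb.
exists k; split=> [|i ik]; last by apply: fk; apply: ltnW.
by move: Eu => /opp_inj <-; rewrite f_finv.
Qed.

(** In a fan, only the first corner can be a boundary side: the later ones are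
    reached by crossing a glued side. *)
Lemma bdry_vertex_inj b b' : bdry b -> bdry b' -> same_vertex b b' -> b = b'.
Proof.
move=> bb bb' /(fan_same_vertex bb)[[|k] [E fk]]; first by rewrite E.
by have := fk k (ltnSn k); rewrite -bdry_opp (_ : opp _ = b') ?bb' // E.
Qed.

(* Turning permutes the corners of a vertex that it never leaves. *)
Let turn_stable (V : {set side X}) :
  (forall x, x \in V -> turn x \in V) -> forall d, d \in V ->
  exists2 x, x \in V & turn x = d.
Proof.
move=> Vt d dV; have E : turn @: V = V.
  apply/eqP; rewrite eqEcard card_imset // leqnn andbT.
  by apply/subsetP=> _ /imsetP[x xV ->]; apply: Vt.
by move: dV; rewrite -{1}E => /imsetP[x xV ->]; exists x.
Qed.

Let turn_vertex d x : x \in vertex d -> ~~ bdry (finv (@nxt X) x) ->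
  turn x \in vertex d.
Proof.
rewrite !in_vertex => dx nx; apply: same_vertex_trans dx _.
by rewrite -{1}[x](f_finv nxt_inj) same_vertex_glued.
Qed.

(* Turning clockwise from the corner that follows a boundary side must end at a
   boundary side: otherwise the clockwise turn would permute the corners of the
   vertex, and no corner can precede the starting one, since the side before it
   is not glued. *)
Let bdry_vertex_nxt b : bdry b -> exists2 b', bdry b' & same_vertex (nxt b) b'.
Proof.
move=> bb; case: (pickP [pred b' | bdry b' && same_vertex (nxt b) b']).
  by move=> b' /andP[]; exists b'.
move=> no; have noV x : x \in vertex (nxt b) -> ~~ bdry x.
  by rewrite in_vertex => bx; have := no x; rewrite /= bx andbT => ->.
pose back x := nxt (opp x).
have backK : cancel turn back by move=> x; rewrite /back /turn oppK f_finv.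
have back_inj : injective back by move=> x y /nxt_inj/opp_inj.
have E : back @: vertex (nxt b) = vertex (nxt b).
  apply/eqP; rewrite eqEcard card_imset // leqnn andbT.
  apply/subsetP=> _ /imsetP[x xV ->]; move: (xV); rewrite !in_vertex => bx.
  apply: same_vertex_trans bx _; rewrite same_vertex_sym -{2}[x]oppK.
  by rewrite same_vertex_glued // bdry_opp noV.
have: nxt b \in back @: vertex (nxt b) by rewrite E vertex_refl.
case/imsetP=> x xV /nxt_inj bx; have := noV x xV.
by rewrite -bdry_opp -bx bb.
Qed.

Lemma bnextP b : bdry b -> bdry (bnext b) /\ same_vertex (nxt b) (bnext b).
Proof.
move=> bb; rewrite /bnext; case: pickP => [b' /and3P[] //|no].
have [b' bb' bb'v] := bdry_vertex_nxt bb.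
by have := no b'; rewrite bb bb' bb'v.
Qed.

Lemma bdry_bnext b : bdry b -> bdry (bnext b).
Proof. by case/bnextP. Qed.

Lemma same_vertex_bnext b : bdry b -> same_vertex (nxt b) (bnext b).
Proof. by case/bnextP. Qed.

Lemma bnextE b b' : bdry b -> bdry b' -> same_vertex (nxt b) b' -> bnext b = b'.
Proof.
move=> bb bb' bv; apply: bdry_vertex_inj => //; first exact: bdry_bnext.
by apply: same_vertex_trans bv; rewrite same_vertex_sym same_vertex_bnext.
Qed.

Lemma bnext_nbdry d : ~~ bdry d -> bnext d = d.
Proof. by move=> /negPf nd; rewrite /bnext; case: pickP => // x; rewrite nd. Qed.

(** The last corner of the fan at the origin of a boundary side follows another
    boundary side, so that [bnext] maps the finite set of boundary sides onto
    itself. *)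
Lemma bnext_inj : injective (@bnext X).
Proof.
have onto b' : bdry b' -> exists2 b, bdry b & bnext b = b'.
  move=> bb'.
  case: (pickP [pred b | bdry b && (nxt b \in vertex b')]) => [b|no].
    case/andP=> bb; rewrite in_vertex same_vertex_sym => bv.
    by exists b; last exact: bnextE.
  have noV x : x \in vertex b' -> ~~ bdry (finv (@nxt X) x).
    by move=> xV; have := no (finv (@nxt X) x); rewrite /= f_finv // xV andbT => ->.
  have [||x xV xb'] := @turn_stable (vertex b') _ b'.
  - by move=> x xV; apply: turn_vertex => //; apply: noV.
  - exact: vertex_refl.
  by have := noV x xV; rewrite -bdry_opp -/(turn x) xb' bb'.
pose B := [set b : side X | bdry b].
have BE : @bnext X @: B = B.
  apply/setP=> b; rewrite inE; apply/imsetP/idP.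
    by case=> x; rewrite inE => /bdry_bnext bx ->.
  by case/onto=> x bx <-; exists x; rewrite ?inE.
have Binj : {in B &, injective (@bnext X)} by apply/imset_injP; rewrite BE.
move=> x y; case: (boolP (bdry x)) (boolP (bdry y)) => bx [] cy E.
- by apply: Binj E; rewrite inE.
- by have := cy; rewrite -(bnext_nbdry cy) -E bdry_bnext.
- by have := bx; rewrite -(bnext_nbdry bx) E bdry_bnext.
by rewrite -(bnext_nbdry bx) E bnext_nbdry.
Qed.

Lemma bdry_iter_bnext b i : bdry b -> bdry (iter i (@bnext X) b).
Proof. by move=> bb; elim: i => //= i; apply: bdry_bnext. Qed.

Lemma hole_bdry b : bdry b -> all (@bdry X) (hole b).
Proof.
move=> bb; apply/allP=> x; rewrite /hole -fconnect_orbit => /iter_findex <-.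
exact: bdry_iter_bnext.
Qed.

End Surface.

Local Open Scope ring_scope.

(** * The Euler characteristic of faces *)

Section Pieces.
Variable X : surface.
Implicit Types (d : side X) (A : {set side X}).

(** The unions of components. *)
Definition piece_closed A :=
  (forall d, (nxt d \in A) = (d \in A)) /\ (forall d, (opp d \in A) = (d \in A)).

Lemma component_refl d : d \in component d.
Proof. by rewrite inE connect0. Qed.

Lemma component_sub d A : piece_closed A -> d \in A -> component d \subset A.
Proof.
move=> [nA oA] dA; apply/subsetP=> x; rewrite inE.
apply: (connect_ind (P := fun z => z \in A)) => // u v uA.
by case/or3P=> /eqP E; [rewrite E nA | rewrite -nA -E | rewrite E oA].
Qed.

Hypothesis X_surface : is_surface X.

Lemma piece_connectC : connect_sym (@piece_rel X).
Proof.
apply: sym_connect_sym => d d'; rewrite /piece_rel.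
rewrite orbCA; congr [|| _, _ | _].
by apply/eqP/eqP=> ->; rewrite X_surface.2.
Qed.

Lemma component_closed d : piece_closed (component d).
Proof.
split=> x; rewrite !inE; apply/esym/(same_connect_r piece_connectC)/connect1.
  by rewrite /piece_rel eqxx.
by rewrite /piece_rel eqxx !orbT.
Qed.

Lemma component_eq d d' : (d' \in component d) = (component d == component d').
Proof.
apply/idP/eqP=> [|->]; last exact: component_refl.
rewrite inE => dd'; apply/setP=> x; rewrite !inE.
exact: (same_connect piece_connectC).
Qed.

Lemma corner_closed A : piece_closed A -> closed (@corner_rel X) A.
Proof.
move=> [nA oA] x y /corner_relP[e _ [] [-> ->]]; by rewrite nA oA.
Qed.

End Pieces.

Lemma sum_bool_card (D : finType) (A : {set D}) (b : pred D) :
  \sum_(d in A) (b d)%:Z = #|[set d in A | b d]|%:Z.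
Proof.
rewrite -sum1dep_card big_mkcondr /= (big_morph Posz PoszD (erefl _)).
by apply: eq_bigr => d _; case: (b d).
Qed.

Section Tangle.
Variable T : diagram.
Hypothesis T_surface : is_surface T.
Hypothesis strand_opp_T : forall d : side T, strand d -> strand (opp d).
Hypothesis strand_interior_T : forall d : side T, strand d -> ~~ bdry d.
Implicit Types (b d : side T) (A : {set side T}).

Lemma strand_oppE d : strand (opp d) = strand d.
Proof.
by apply/idP/idP=> /strand_opp_T //; rewrite T_surface.2.
Qed.

Lemma opp_cut d : @opp (cut T) d = if strand d then d else opp d.
Proof. by []. Qed.

Lemma nxt_cut d : @nxt (cut T) d = nxt d.
Proof. by []. Qed.

Lemma cut_surface : is_surface (cut T).
Proof.
split; first exact: T_surface.1.
move=> d; rewrite !opp_cut; case: (boolP (strand d)) => [->|/negPf sd] //.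
by rewrite strand_oppE sd T_surface.2.
Qed.

Lemma bdry_cut d : bdry (X := cut T) d = bdry d || strand d.
Proof. by rewrite /bdry opp_cut; case: ifP => sd; rewrite ?eqxx ?orbT ?orbF. Qed.

(** At such a corner, neither the tangle nor the boundary meets the vertex, and
    the surface coincides with its cut along the tangle. *)
Definition isolated d : bool :=
  [forall x in vertex d, ~~ bdry x && ~~ strand x].

Lemma vertex_cut_sub d : vertex (X := cut T) d \subset vertex d.
Proof.
apply: (@vertex_sub (cut T) (vertex d) d) (vertex_refl d) => e.
rewrite bdry_cut negb_or => /andP[ne se].
rewrite nxt_cut opp_cut (negPf se).
change ((nxt (e : side T) \in vertex d) = (opp (e : side T) \in vertex d)).
rewrite !in_vertex; by apply: (same_connect_r (@same_vertexC T)); apply: same_vertex_glued.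
Qed.

(* The sides of T and of its cut form convertible, yet syntactically different
   types; this states [in_vertex] for the former. *)
Lemma in_vertex_cut d x :
  (x \in (vertex (X := cut T) d : {set side T})) = same_vertex (X := cut T) d x.
Proof. exact: (@in_vertex (cut T)). Qed.

(** Cutting along a strand that ends at a vertex leaves boundary there, so a cut
    vertex off the boundary is an uncut vertex. *)
Lemma isolated_cut d :
  isolated d = [forall x in vertex (X := cut T) d, ~~ bdry (X := cut T) x].
Proof.
apply/idP/idP=> /forall_inP iso; apply/forall_inP=> x xv.
  by rewrite bdry_cut negb_or; apply: iso; apply: (subsetP (vertex_cut_sub d)).
rewrite -negb_or -bdry_cut; apply: (iso); apply: subsetP xv.
apply: (@vertex_sub T (vertex (X := cut T) d)); last exact: (@vertex_refl (cut T)).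
move=> e ne.
case: (boolP (strand e)) => se; last first.
  have ce : ~~ bdry (X := cut T) e by rewrite bdry_cut negb_or ne.
  have := same_vertex_glued ce; rewrite nxt_cut opp_cut (negPf se) => h.
  rewrite !in_vertex_cut.
  exact: (same_connect_r (@same_vertexC (cut T)) h).
(* A strand side e bounds the cut surface. So does [opp e], which thus is not at
   this vertex; neither is [nxt e], as a boundary side of the cut surface issues
   from the head of e. *)
have bc : bdry (X := cut T) e by rewrite bdry_cut se orbT.
apply/idP/idP=> eV.
  have [bn sn] := bnextP cut_surface bc.
  suff /iso : bnext (X := cut T) e \in vertex (X := cut T) d by rewrite bn.
  rewrite in_vertex; move: eV; rewrite in_vertex_cut => eV.
  exact: same_vertex_trans eV sn.
by have := iso _ eV; rewrite bdry_cut strand_oppE se orbT.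
Qed.

Lemma vertex_cut_isolated d : isolated d -> vertex (X := cut T) d = vertex d.
Proof.
move=> /forall_inP iso; apply/eqP; rewrite eqEsubset vertex_cut_sub /=.
apply/subsetP=> x; rewrite in_vertex in_vertex_cut => dx.
suff [] : same_vertex (X := cut T) d x /\ same_vertex d x by [].
apply: (connect_ind (P := fun x =>
  same_vertex (X := cut T) d x /\ same_vertex d x)) dx.
  by split; apply: connect0.
move=> u v [uc ud] uv; have vd := connect_trans ud (connect1 uv).
split=> //; apply: connect_trans uc _.
have glued e : ~~ bdry e -> same_vertex d (opp e) ->
    same_vertex (X := cut T) (nxt e) (opp e).
  rewrite -in_vertex => ne /iso/andP[_]; rewrite strand_oppE => se.
  have ce : ~~ bdry (X := cut T) e by rewrite bdry_cut negb_or ne.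
  by have := same_vertex_glued ce; rewrite nxt_cut opp_cut (negPf se).
case/corner_relP: uv ud vd => e ne [] [-> ->] ud vd; first exact: glued.
by rewrite -/(same_vertex (X := cut T) _ _) same_vertex_sym; apply: glued.
Qed.

Lemma isolatedE d d' : same_vertex d d' -> isolated d = isolated d'.
Proof. by move=> /vertexE E; rewrite /isolated E. Qed.

Lemma isolated_bdry_cut d : isolated d -> ~~ bdry (X := cut T) d.
Proof. by move=> /forall_inP/(_ d (vertex_refl d)); rewrite bdry_cut negb_or. Qed.

(** Selects one corner of each isolated vertex, which turns the number of isolated
    vertices of a face into a sum over its sides. *)
Definition isolated_root d := isolated d && (d \in roots (@corner_rel T)).

(** A vertex of the cut surface is either isolated or the origin of a single
    boundary side of the cut surface. *)
Lemma n_comp_corner_cut A : piece_closed (X := cut T) A ->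
  n_comp (corner_rel (X := cut T)) A =
    (#|[set d in A | isolated_root d]| + #|[set d in A | bdry d || strand d]|)%N.
Proof.
move=> Acl; have Acorner := corner_closed Acl.
rewrite -cardsUI [X in (_ + X)%N]eq_card0 ?addn0; last first.
  move=> d; rewrite !inE; apply: contraTF isT => /andP[/and3P[_ iso _] /andP[_]].
  by rewrite -bdry_cut => bd; have := isolated_bdry_cut iso; rewrite bd.
apply: n_comp_transversal (Acorner) _ _ _ => //.
- exact: same_vertexC.
- by apply/subsetP=> d; rewrite !inE => /orP[] /andP[].
- have mix x y : isolated x -> bdry (X := cut T) y ->
      connect (corner_rel (X := cut T)) x y -> False.
    rewrite isolated_cut => /forall_inP iso yb xy.
    by have := iso y; rewrite yb in_vertex => /(_ xy).
  move=> x y; rewrite !inE -!bdry_cut -!andb_orr => /andP[_ xK] /andP[_ yK] xy.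
  case/orP: xK yK => [/andP[xi xr]|xb] /orP[/andP[yi yr]|yb].
  + move: xy; rewrite -[connect _ _ _]in_vertex_cut vertex_cut_isolated //.
    rewrite in_vertex => /(fingraph.rootP (@same_vertexC T)).
    by rewrite (eqP xr) (eqP yr).
  + by case: (mix x y).
  + by case: (mix y x); rewrite // same_vertexC.
  + exact: (bdry_vertex_inj cut_surface).
move=> x xA; case: (boolP (isolated x)) => [xi|].
  pose r := fingraph.root (@corner_rel T) x.
  have xr : @same_vertex T x r by apply: (connect_root (@corner_rel T)).
  have xcr : same_vertex (X := cut T) x r.
    by rewrite -in_vertex_cut vertex_cut_isolated // in_vertex.
  have rr : r \in roots (@corner_rel T) by apply: roots_root; apply: same_vertexC.
  exists r => //; rewrite in_setU !in_set /isolated_root -(isolatedE xr) xi rr.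
  by rewrite -(closed_connect Acorner xcr) xA.
rewrite isolated_cut => /forall_inPn[y yv]; rewrite negbK => yb.
move: yv; rewrite in_vertex => xy; exists y => //.
by rewrite !inE -bdry_cut yb -(closed_connect Acorner xy) xA orbT.
Qed.

(** The contribution of a side d to twice the Euler characteristic of its face,
    diminished by one if the face meets the boundary in an arc. Once strands are
    cut, each glued side counts for half an edge and each boundary side for one
    edge and one vertex; the vertices of the cut surface still to be counted are
    the isolated ones. The last term selects one side of each polygon. An isolated vertex inside the surface weighs 2 and the
    vertex of a boundary circle disjoint from the tangle weighs 1, so that
    pasting two such circles preserves the total weight. *)
Definition side_weight d : int :=
  2 * (isolated_root d)%:Z + (bdry d && (degree d == 0%N))%:Z + (strand d)%:Z - 1
  + 2 * (d \in roots (frel (@nxt T)))%:Z.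

Lemma euler_cut A : piece_closed (X := cut T) A ->
  2 * euler (X := cut T) A =
  \sum_(d in A) side_weight d
  + #|[set d in A | bdry d && (degree d != 0%N)]|%:Z.
Proof.
move=> Acl; rewrite /euler n_comp_corner_cut //.
have Aopp : fclosed (@opp (cut T)) A by move=> x _ /eqP <-; rewrite Acl.2.
have cE := fcard_involutive cut_surface.2 Aopp.
have -> : fcard (@nxt (cut T)) A = #|[set d in A | d \in roots (frel (@nxt T))]|.
  by apply: eq_card => d; rewrite !inE andbC.
rewrite /side_weight !big_split /= -!mulr_sumr !sum_bool_card sumr_const.
have E1 : [set d in A | opp (s := cut T) d == d] = [set d in A | bdry d || strand d].
  by apply/setP=> d; rewrite !inE -bdry_cut.
rewrite {}E1 in cE.
have E2 : (#|[set d in A | bdry d || strand d]| =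
    #|[set d in A | bdry d]| + #|[set d in A | strand d]|)%N.
  rewrite -cardsUI [X in (_ + X)%N]eq_card0 ?addn0.
    by apply: eq_card => d; rewrite !inE andb_orr.
  move=> d; rewrite !inE; apply: contraTF isT => /andP[/andP[_ bd] /andP[_]].
  by move=> /strand_interior_T; rewrite bd.
have E3 : (#|[set d in A | bdry d]| =
    #|[set d in A | bdry d && (degree d == 0)]| +
    #|[set d in A | bdry d && (degree d != 0)]|)%N.
  rewrite -cardsUI [X in (_ + X)%N]eq_card0 ?addn0.
    by apply: eq_card => d; rewrite !inE -!andb_orr orbN andbT.
  by move=> d; rewrite !inE; case: (degree d == 0%N); rewrite ?andbF.
rewrite E2 E3 in cE *; rewrite mulNrn natz.
move: cE; move: (fcard _ A) #|A| => m n; lia.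
Qed.

End Tangle.

Local Close Scope ring_scope.

(** * Pasting two diagrams *)

(** The part of a pasted diagram P that comes from one of the two pieces, T,
    embedded by j; the images of T under j and of T' under j' are pasted along
    sides that P declares opposite. Stating the hypotheses for each piece
    separately makes the situation symmetric, so that every fact about T also
    holds for T'. *)
Record half_pasting (P T T' : diagram) (j : side T -> side P)
    (j' : side T' -> side P) : Prop := HalfPasting {
  half_inj : injective j;
  half_disjoint : forall a a', j a <> j' a';
  half_nxt : forall a, nxt (j a) = j (nxt a);
  half_strand : forall a, strand (j a) = strand a;
  half_over : forall a, over (j a) = over a;
  half_opp : forall a, opp (j a) = j (opp a) \/ exists a', opp (j a) = j' a';
  half_glued : forall a a', opp (j a) = j' a' -> bdry a /\ opp (j' a') = j a;
  (* The two sides of a pasted hole are run in opposite directions. *)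
  half_bnext : forall a a', opp (j a) = j' a' ->
    exists2 c', opp (j (bnext a)) = j' c' & bnext c' = a';
  (* Pasted holes either both meet their tangle or are both disjoint from it. *)
  half_degree : forall a a', opp (j a) = j' a' ->
    (degree a == 0) = (degree a' == 0)
}.

Record pasting (P T T' : diagram) (j : side T -> side P)
    (j' : side T' -> side P) : Prop := Pasting {
  pasting_left : half_pasting j j';
  pasting_right : half_pasting j' j;
  pasting_cover : forall d, (exists a, d = j a) \/ (exists a', d = j' a')
}.

Lemma pasting_sym (P T T' : diagram) (j : side T -> side P) (j' : side T' -> side P) :
  pasting j j' -> pasting j' j.
Proof.
by case=> H H' cov; split=> // d; case: (cov d); [right | left].
Qed.

Lemma is_tangle_degree_le1 (T : diagram) (b : side T) :
  is_tangle T -> bdry b -> (degree b <= 1)%N.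
Proof. by move=> HT /(degree_bdry HT)[-> | [-> _]]. Qed.

(** A boundary vertex off the tangle is alone on its hole. *)
Lemma is_tangle_degree0_bnext (T : diagram) (b : side T) :
  is_tangle T -> bdry b -> degree b = 0%N -> bnext b = b.
Proof.
move=> HT /(degree_bdry HT)[-> // | [_]]; rewrite /hole size_orbit => ob _.
have := iter_order (bnext_inj (tangle_surface HT)) b; by rewrite ob.
Qed.

Lemma degreeE (T : diagram) (d d' : side T) : same_vertex d d' -> degree d = degree d'.
Proof. by move=> /vertexE E; rewrite /degree E. Qed.

Section Vertices.
Variables (P T T' : diagram) (j : side T -> side P) (j' : side T' -> side P).
Hypotheses (HT : is_tangle T) (pst : pasting j j').
Let H := pasting_left pst.
Let H' := pasting_right pst.
Implicit Types a b d x : side T.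

Let T_surface := tangle_surface HT.

Lemma pasted_ind (Q : side P -> Prop) :
  (forall a, Q (j a)) -> (forall a' : side T', Q (j' a')) -> forall d : side P, Q d.
Proof.
by move=> Qj Qj' d; case: (pasting_cover pst d) => [[a ->]|[a' ->]].
Qed.

Definition glued a : bool := [exists a' : side T', opp (j a) == j' a'].

Lemma gluedP a : reflect (exists a' : side T', opp (j a) = j' a') (glued a).
Proof. by apply: (iffP existsP) => -[a' E]; exists a'; apply/eqP. Qed.

Lemma glued_bdry a : glued a -> bdry a.
Proof. by case/gluedP=> a' /(half_glued H)[]. Qed.

Lemma opp_unglued a : ~~ glued a -> opp (j a) = j (opp a).
Proof. by move=> /gluedP na; case: (half_opp H a). Qed.

Lemma opp_pasted_nbdry a : ~~ bdry a -> opp (j a) = j (opp a).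
Proof. by move=> na; apply: opp_unglued; apply: contra na => /glued_bdry. Qed.

Lemma bdry_pasted a : bdry (j a) = bdry a && ~~ glued a.
Proof.
rewrite andbC; case: (boolP (glued a)) => [/gluedP[a' E]|/opp_unglued E] /=.
  by rewrite /bdry E; apply/eqP => /esym/(half_disjoint H).
by rewrite /bdry E (inj_eq (half_inj H)).
Qed.

(** Holes are pasted entirely or not at all. *)
Lemma glued_bnext a : glued (bnext a) = glued a.
Proof.
apply/gluedP/gluedP=> [] [a' E].
  have [_ /(half_bnext H') [c]] := half_glued H E.
  move=> /(half_glued H')[_ Ec] /(bnext_inj T_surface) ca.
  by exists (bnext a'); rewrite -ca.
by have [c' Ec' _] := half_bnext H E; exists c'.
Qed.

Lemma imset_pastedE (U : {set side T}) (U' : {set side T'}) a :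
  (j a \in j @: U :|: j' @: U') = (a \in U).
Proof.
rewrite in_setU mem_imset; last exact: half_inj H.
by case: imsetP => [[a' _ /(half_disjoint H)] //|_]; rewrite orbF.
Qed.

Lemma same_vertex_pasted d x : same_vertex d x -> same_vertex (j d) (j x).
Proof.
apply: (connect_ind (P := fun x => same_vertex (j d) (j x))).
  exact: same_vertex_refl.
move=> u v du uv; apply: same_vertex_trans du _.
have glue e : ~~ bdry e -> same_vertex (j (nxt e)) (j (opp e)).
  move=> ne; rewrite -(half_nxt H) -opp_pasted_nbdry //.
  by apply: same_vertex_glued; rewrite bdry_pasted negb_and ne.
by case/corner_relP: uv => e /glue ne [] [-> ->]; rewrite // same_vertex_sym.
Qed.

Lemma mem_vertex_nxt d a :
  bdry a -> (nxt a \in vertex d) = (bnext a \in vertex d).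
Proof.
move=> ba; rewrite !in_vertex.
exact: (same_connect_r (@same_vertexC T)) (same_vertex_bnext T_surface ba) d.
Qed.

End Vertices.

Lemma vertex_stable (X : surface) (d e : side X) :
  ~~ bdry e -> (nxt e \in vertex d) = (opp e \in vertex d).
Proof.
move=> ne; rewrite !in_vertex.
exact: (same_connect_r (@same_vertexC X)) (same_vertex_glued ne) d.
Qed.

Section PastedVertices.
Variables (P T T' : diagram) (j : side T -> side P) (j' : side T' -> side P).
Hypotheses (HT : is_tangle T) (HT' : is_tangle T') (pst : pasting j j').
Let H := pasting_left pst.
Let H' := pasting_right pst.
Let tsp := pasting_sym pst.
Implicit Types a b d x : side T.

Lemma pasted_surface : is_surface P.
Proof.
split.
  move=> d d'; elim/(pasted_ind pst): d => [a|a'];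
    elim/(pasted_ind pst): d' => [b|b'];
    rewrite ?(half_nxt H) ?(half_nxt H').
  - by move=> /(half_inj H)/(tangle_surface HT).1->.
  - by move/(half_disjoint H).
  - by move/(half_disjoint H').
  - by move=> /(half_inj H')/(tangle_surface HT').1->.
have oppK (Q1 Q2 : diagram) (k : side Q1 -> side P) (k' : side Q2 -> side P)
    (HQ : is_tangle Q1) (ps : pasting k k') (a : side Q1) : opp (opp (k a)) = k a.
  have K := pasting_left ps.
  case: (boolP (glued k k' a)) => [/gluedP[a' E]|na].
    by rewrite E; case: (half_glued K E).
  rewrite (opp_unglued ps) //; case: (boolP (bdry a)) => [/eqP ba|ba].
    by rewrite !ba (opp_unglued ps) // ba.
  rewrite (opp_pasted_nbdry ps) ?(tangle_surface HQ).2 //.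
  by rewrite (bdry_opp (tangle_surface HQ)).
move=> d; elim/(pasted_ind pst): d => a; first exact: (oppK _ _ _ _ HT pst).
exact: (oppK _ _ _ _ HT' tsp).
Qed.

Lemma pasted_strand_interior (d : side P) : strand d -> ~~ bdry d.
Proof.
elim/(pasted_ind pst): d => a.
  rewrite (half_strand H) (bdry_pasted pst) negb_and.
  by move/(strand_interior HT)->.
rewrite (half_strand H') (bdry_pasted tsp) negb_and.
by move/(strand_interior HT')->.
Qed.

Lemma opp_pasted_strand a : strand a -> opp (j a) = j (opp a).
Proof. by move/(strand_interior HT)/(opp_pasted_nbdry pst). Qed.

Lemma glued_partner a (a' : side T') : opp (j a) = j' a' -> glued j j' a /\ glued j' j a'.
Proof.
move=> E; split; apply/gluedP; first by exists a'.
by exists a; case: (half_glued H E).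
Qed.

(** Two unions of vertices of the pieces give a union of vertices of the whole as
    soon as they match along the pasted sides: the head of a pasted side is the
    origin of its partner. *)
Lemma pasted_vertex_closed (U : {set side T}) (U' : {set side T'}) :
    (forall e, ~~ bdry e -> (nxt e \in U) = (opp e \in U)) ->
    (forall e, ~~ bdry e -> (nxt e \in U') = (opp e \in U')) ->
    (forall a (a' : side T'), opp (j a) = j' a' ->
       (nxt a \in U) = (a' \in U') /\ (nxt a' \in U') = (a \in U)) ->
  forall e, ~~ bdry e ->
    (nxt e \in j @: U :|: j' @: U') = (opp e \in j @: U :|: j' @: U').
Proof.
move=> Ucl U'cl UU' e.
have mem (a' : side T') : (j' a' \in j @: U :|: j' @: U') = (a' \in U').
  by rewrite setUC (imset_pastedE tsp).
elim/(pasted_ind pst): e => a.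
  rewrite (half_nxt H) (imset_pastedE pst).
  case: (boolP (glued j j' a)) => [/gluedP[a' E] _|na].
    by rewrite E mem (UU' _ _ E).1.
  rewrite (bdry_pasted pst) na andbT (opp_unglued pst) //.
  by rewrite (imset_pastedE pst) => /Ucl.
rewrite (half_nxt H') mem.
case: (boolP (glued j' j a)) => [/gluedP[b E] _|na].
  by have [_ E'] := half_glued H' E; rewrite E (imset_pastedE pst) (UU' _ _ E').2.
by rewrite (bdry_pasted tsp) na andbT (opp_unglued tsp) // mem => /U'cl.
Qed.

Lemma vertex_unglued d :
  (forall a, a \in vertex d -> ~~ glued j j' a) -> vertex (j d) = j @: vertex d.
Proof.
move=> ung; apply/eqP; rewrite eqEsubset; apply/andP; split; last first.
  apply/subsetP=> _ /imsetP[x xd ->].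
  by rewrite in_vertex (same_vertex_pasted pst) // -in_vertex.
have -> : j @: vertex d = j @: vertex d :|: j' @: set0 by rewrite imset0 setU0.
apply: vertex_sub; last by rewrite (imset_pastedE pst) vertex_refl.
apply: pasted_vertex_closed => [e||a a' E]; first exact: vertex_stable.
  by move=> e _; rewrite !inE.
have [ga _] := glued_partner E; rewrite !in_set0.
rewrite (mem_vertex_nxt HT) ?(glued_bdry pst ga) //.
split; first by apply: contraTF ga => /ung; rewrite (glued_bnext HT pst).
by apply/esym; apply: contraTF ga => /ung.
Qed.

(** The origin of a pasted side is the head of its partner, which is the origin of
    the boundary side after the partner. *)
Lemma vertex_glued a (a' : side T') : opp (j a) = j' a' ->
  vertex (j a) = j @: vertex a :|: j' @: vertex (bnext a').
Proof.
move=> E; have [ba E'] := half_glued H E; have [ba' _] := half_glued H' E'.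
have surj := bnext_inj (tangle_surface HT).
have surj' := bnext_inj (tangle_surface HT').
apply/eqP; rewrite eqEsubset; apply/andP; split.
  apply: vertex_sub; last by rewrite (imset_pastedE pst) vertex_refl.
  apply: pasted_vertex_closed => [e|e|c c' Ec]; try exact: vertex_stable.
  have [bc Ec'] := half_glued H Ec; have [bc' _] := half_glued H' Ec'.
  rewrite (mem_vertex_nxt HT) // (mem_vertex_nxt HT') //.
  have uniq_bdry (Q : diagram) (HQ : is_tangle Q) (x y : side Q) :
      bdry x -> bdry y -> (x \in vertex y) = (x == y).
    move=> bx by'; rewrite in_vertex; apply/idP/eqP=> [|->]; last exact: same_vertex_refl.
    by move/(bdry_vertex_inj (tangle_surface HQ) by' bx).
  rewrite !uniq_bdry ?(bdry_bnext (tangle_surface HT)) //;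
    try exact: (bdry_bnext (tangle_surface HT')).
  have [e' Ee' ec'] := half_bnext H Ec.
  have inj_partner x y y' : opp (j x) = j' y -> opp (j x) = j' y' -> y = y'.
    by move=> -> /(half_inj H').
  have partner_inj x y z : opp (j x) = j' z -> opp (j y) = j' z -> x = y.
    by move=> Ex Ey; apply/(half_inj H)/(inv_inj pasted_surface.2); rewrite Ex.
  split; last first.
    rewrite (inj_eq surj'); apply/eqP/eqP=> [c'a|ca].
      by apply: partner_inj Ec _; rewrite c'a.
    by apply: inj_partner Ec _; rewrite ca.
  rewrite -ec' (inj_eq surj'); apply/eqP/eqP=> [ca|e'a].
    by apply: inj_partner Ee' _; rewrite ca.
  by apply: partner_inj Ee' _; rewrite e'a.
apply/subsetP=> _ /setUP[] /imsetP[x xv ->]; rewrite in_vertex.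
  by apply: (same_vertex_pasted pst); rewrite -in_vertex.
have na' : ~~ bdry (j' a').
  by rewrite (bdry_pasted tsp) (glued_partner E).2 andbF.
have := same_vertex_glued na'; rewrite (half_nxt H') E' same_vertex_sym => h.
apply: (same_vertex_trans h); apply: (same_vertex_pasted tsp).
apply: same_vertex_trans (same_vertex_bnext (tangle_surface HT') ba') _.
by rewrite -in_vertex.
Qed.

Let card_pasted (V : {set side T}) :
  #|[set t in j @: V | strand t]| = #|[set t in V | strand t]|.
Proof.
rewrite -(card_imset (mem [set t in V | strand t]) (half_inj H)).
apply: eq_card => t; rewrite inE; apply/andP/imsetP.
  by case=> /imsetP[x xV ->] xs; exists x; rewrite // inE xV -(half_strand H).
by case=> x; rewrite inE => /andP[xV xs] ->; rewrite imset_f // (half_strand H).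
Qed.

Lemma degree_unglued d :
  (forall a, a \in vertex d -> ~~ glued j j' a) -> degree (j d) = degree d.
Proof. by move=> ung; rewrite /degree vertex_unglued // card_pasted. Qed.

End PastedVertices.

Section PastedDegrees.
Variables (P T T' : diagram) (j : side T -> side P) (j' : side T' -> side P).
Hypotheses (HT : is_tangle T) (HT' : is_tangle T') (pst : pasting j j').
Let H := pasting_left pst.
Let H' := pasting_right pst.
Let tsp := pasting_sym pst.
Implicit Types a b d x : side T.

(** One endpoint of the tangle, at most, comes from each piece. *)
Lemma degree_glued a : glued j j' a -> (degree (j a) <= 2)%N.
Proof.
case/gluedP=> a' E; have [ba E'] := half_glued H E; have [ba' _] := half_glued H' E'.
have d1 := is_tangle_degree_le1 HT ba.
have d2 := is_tangle_degree_le1 HT' (bdry_bnext (tangle_surface HT') ba').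
rewrite /degree (vertex_glued HT HT' pst E).
have cs (Q1 Q2 : diagram) (k : side Q1 -> side P) (k' : side Q2 -> side P)
    (K : half_pasting k k') (V : {set side Q1}) :
    (#|[set t in k @: V | strand t]| <= #|[set t in V | strand t]|)%N.
  rewrite -(card_imset (mem [set t in V | strand t]) (half_inj K)).
  apply: subset_leq_card; apply/subsetP=> t; rewrite inE => /andP[/imsetP[x xV ->]].
  by rewrite (half_strand K) => xs; rewrite imset_f // inE xV.
have -> : [set t in j @: vertex a :|: j' @: vertex (bnext a') | strand t] =
  [set t in j @: vertex a | strand t] :|:
  [set t in j' @: vertex (bnext a') | strand t].
  by apply/setP=> t; rewrite !inE andb_orl.
apply: leq_trans (leq_card_setU _ _) _.
apply: (leq_trans (leq_add (cs _ _ _ _ H _) (cs _ _ _ _ H' _))).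
exact: (leq_add d1 d2).
Qed.

End PastedDegrees.

Local Open Scope ring_scope.

(** * The weights of sides under pasting *)

Section PastedIsolated.
Variables (P T T' : diagram) (j : side T -> side P) (j' : side T' -> side P).
Hypotheses (HT : is_tangle T) (HT' : is_tangle T') (pst : pasting j j').
Let H := pasting_left pst.
Let H' := pasting_right pst.
Let tsp := pasting_sym pst.
Implicit Types (a b d x : side T) (F : {set side P}).

Lemma pasted_strand_opp (d : side P) : strand d -> strand (opp d).
Proof.
elim/(pasted_ind pst): d => a.
  by rewrite (half_strand H) => sa;
    rewrite (opp_pasted_strand HT pst) // (half_strand H) (strand_opp HT).
by rewrite (half_strand H') => sa;
  rewrite (opp_pasted_strand HT' tsp) // (half_strand H') (strand_opp HT').
Qed.

Lemma isolated_strand (Q : diagram) (d x : side Q) :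
  isolated d -> same_vertex d x -> ~~ bdry x && ~~ strand x.
Proof. by move=> /forall_inP iso dx; apply: iso; rewrite in_vertex. Qed.

Lemma degree_eq0 (Q : diagram) (d : side Q) :
  (degree d == 0)%N = [forall x in vertex d, ~~ strand x].
Proof.
rewrite cards_eq0; apply/eqP/forall_inP=> [d0 x xd|d0].
  by apply/negP=> xs; have := in_set0 x; rewrite -d0 inE xd xs.
by apply/setP=> x; rewrite !inE; apply/negP=> /andP[xd]; apply/negP/d0; rewrite inE.
Qed.

Lemma isolated_unglued d : (forall a, a \in vertex d -> ~~ glued j j' a) ->
  isolated (j d) = isolated d.
Proof.
move=> ung; rewrite /isolated (vertex_unglued HT pst) //.
apply/forall_inP/forall_inP=> iso x.
  move=> xd; have := iso (j x) (imset_f _ xd).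
  by rewrite (half_strand H) (bdry_pasted pst) ung ?andbT.
case/imsetP=> y yd ->; have := iso y yd.
by rewrite (half_strand H) (bdry_pasted pst) ung ?andbT.
Qed.

Lemma isolated_unglued_vertex d a :
  isolated d -> a \in vertex d -> ~~ glued j j' a.
Proof.
move=> /forall_inP iso /iso /andP[ba _].
by apply: contra ba => /(glued_bdry pst).
Qed.

Lemma isolated_pasted d : isolated d -> isolated (j d).
Proof. by move=> iso; rewrite isolated_unglued // => a; apply: isolated_unglued_vertex. Qed.

(** A pasted boundary circle disjoint from the tangles becomes a closed curve
    through a single vertex, around which no strand or boundary is left. *)
Lemma isolated_glued a : glued j j' a -> isolated (j a) = (degree a == 0%N).
Proof.
move=> ga; case/gluedP: (ga) => a' E; have [ba E'] := half_glued H E.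
have [ba' _] := half_glued H' E'; have vE := vertex_glued HT HT' pst E.
apply/idP/idP=> [/forall_inP iso|a0].
  rewrite degree_eq0; apply/forall_inP=> x xa; rewrite -(half_strand H).
  by have := iso (j x); rewrite vE in_setU imset_f // => /(_ isT)/andP[].
have a'0 : degree a' == 0%N by rewrite -(half_degree H E).
have a'1 := is_tangle_degree0_bnext HT' ba' (eqP a'0).
apply/forall_inP=> x; rewrite vE a'1 => /setUP[] /imsetP[y yv ->].
  rewrite (half_strand H) (bdry_pasted pst); move: a0.
  rewrite degree_eq0 => /forall_inP->; rewrite // andbT negb_and negbK.
  case: (boolP (bdry y)) => //= bye; move: yv; rewrite in_vertex.
  by move/(bdry_vertex_inj (tangle_surface HT) ba bye) <-.
rewrite (half_strand H') (bdry_pasted tsp); move: a'0.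
rewrite degree_eq0 => /forall_inP->; rewrite // andbT negb_and negbK.
case: (boolP (bdry y)) => //= bye; move: yv; rewrite in_vertex.
move/(bdry_vertex_inj (tangle_surface HT') ba' bye) <-.
exact: (glued_partner pst E).2.
Qed.

(** A boundary vertex of degree zero is alone on its hole, which is then a circle
    disjoint from the tangle. *)
Definition glued_circles F : {set side T} :=
  [set a | [&& j a \in F, glued j j' a & degree a == 0%N]].

Lemma fconnect_nxt_pasted a (d : side P) :
  fconnect (@nxt P) (j a) d <-> exists2 b, d = j b & fconnect (@nxt T) a b.
Proof.
have iterE i : iter i (@nxt P) (j a) = j (iter i (@nxt T) a).
  by elim: i => //= i ->; rewrite (half_nxt H).
split=> [/iter_findex <-|[b -> /iter_findex <-]].
  by rewrite iterE; eexists; first by []; apply: fconnect_iter.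
by rewrite -iterE fconnect_iter.
Qed.

Lemma same_vertex_isolated_pasted d (x : side P) : isolated d ->
  same_vertex (j d) x -> exists2 y, x = j y & same_vertex d y.
Proof.
move=> iso; rewrite -in_vertex (vertex_unglued HT pst).
  by case/imsetP=> y; rewrite in_vertex; exists y.
by move=> a; apply: isolated_unglued_vertex.
Qed.

Lemma same_vertex_glued_pasted a b :
  glued j j' a -> same_vertex (j a) (j b) -> same_vertex a b.
Proof.
case/gluedP=> a' E; rewrite -in_vertex (vertex_glued HT HT' pst E).
by rewrite (imset_pastedE pst) in_vertex.
Qed.

End PastedIsolated.

Section PastedPolygons.
Variables (P T T' : diagram) (j : side T -> side P) (j' : side T' -> side P).
Hypotheses (HT : is_tangle T) (HT' : is_tangle T') (pst : pasting j j').
Let H := pasting_left pst.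
Let H' := pasting_right pst.
Let tsp := pasting_sym pst.
Let P_surface := pasted_surface HT HT' pst.
Implicit Types (F : {set side P}).

Lemma pasted_setE F : F = j @: (j @^-1: F) :|: j' @: (j' @^-1: F).
Proof.
apply/setP=> d; elim/(pasted_ind pst): d => a.
  by rewrite (imset_pastedE pst) inE.
by rewrite setUC (imset_pastedE tsp) inE.
Qed.

Lemma card_pasted_set F : #|F| = (#|j @^-1: F| + #|j' @^-1: F|)%N.
Proof.
rewrite {1}[F]pasted_setE cardsU (_ : _ :&: _ = set0).
  by rewrite cards0 subn0 !card_imset //; [apply: half_inj H' | apply: half_inj H].
apply/setP=> d; rewrite !inE.
by apply/negP=> /andP[/imsetP[a _ ->] /imsetP[a' _ /(half_disjoint H)]].
Qed.

Lemma fcard_nxt_pasted F : piece_closed (X := cut P) F ->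
  #|[set d in F | d \in roots (frel (@nxt P))]| =
  (#|[set a in j @^-1: F | a \in roots (frel (@nxt T))]| +
   #|[set a in j' @^-1: F | a \in roots (frel (@nxt T'))]|)%N.
Proof.
move=> Fcl; have nC (Q : diagram) (HQ : is_surface Q) : connect_sym (frel (@nxt Q)).
  exact/fconnect_sym/HQ.1.
pose R (Q : diagram) (k : side Q -> side P) :=
  [set a in k @^-1: F | a \in roots (frel (@nxt Q))].
have Fn : fclosed (@nxt P) F by move=> x _ /eqP <-; rewrite Fcl.1.
have RE (Q Q' : diagram) (k : side Q -> side P) (k' : side Q' -> side P)
    (HQ : is_tangle Q) (ps : pasting k k') (a b : side Q) :
    k a \in k @: R Q k -> k b \in k @: R Q k ->
    fconnect (@nxt P) (k a) (k b) -> k a = k b.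
  have K := pasting_left ps; rewrite !mem_imset ?inE; try exact: half_inj K.
  move=> /andP[_ /eqP ra] /andP[_ /eqP rb] /(fconnect_nxt_pasted ps)[c /(half_inj K) <-].
  by move=> /(fingraph.rootP (nC Q (tangle_surface HQ))); rewrite ra rb => ->.
have cross (Q Q' : diagram) (k : side Q -> side P) (k' : side Q' -> side P)
    (ps : pasting k k') a b : fconnect (@nxt P) (k a) (k' b) -> False.
  by case/(fconnect_nxt_pasted ps)=> c /esym/(half_disjoint (pasting_left ps)).
have surj (Q Q' : diagram) (k : side Q -> side P) (k' : side Q' -> side P)
    (HQ : is_tangle Q) (ps : pasting k k') a : k a \in F ->
    exists2 b, b \in R Q k & fconnect (@nxt P) (k a) (k b).
  move=> aF; exists (froot (@nxt Q) a); last first.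
    by apply/(fconnect_nxt_pasted ps); eexists; [by []|apply: connect_root].
  have rr : froot (@nxt Q) a \in roots (frel (@nxt Q)).
    by apply: roots_root; apply/nC/tangle_surface.
  rewrite in_set rr andbT in_set -(closed_connect Fn (x := k a)) //.
  by apply/(fconnect_nxt_pasted ps); eexists; [by []|apply: connect_root].
rewrite -[LHS]/#|_| (_ : #|[set d in F | _]| = fcard (@nxt P) F); last first.
  by apply: eq_card => d; rewrite !inE andbC.
rewrite -!/(R _ _) (n_comp_transversal (B := j @: R T j :|: j' @: R T' j')) //.
- rewrite (card_pasted_set (_ :|: _)); congr (_ + _)%N; apply: eq_card => a.
    by rewrite [in LHS]inE (imset_pastedE pst).
  by rewrite [in LHS]inE setUC (imset_pastedE tsp).
- exact: nC P_surface.
- by apply/subsetP=> d /setUP[] /imsetP[a]; rewrite !inE => /andP[aF _] ->.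
- move=> x y xR yR; move: xR yR.
  move=> /setUP[] /imsetP[a aR ->] /setUP[] /imsetP[b bR ->].
  + by apply: RE HT pst _ _ _ _; apply: imset_f.
  + by move/(cross _ _ _ _ pst).
  + by move/(cross _ _ _ _ tsp).
  + by apply: RE HT' tsp _ _ _ _; apply: imset_f.
move=> x; elim/(pasted_ind pst): x => a aF.
  have [b bR ab] := surj _ _ _ _ HT pst a aF.
  by exists (j b); rewrite // in_setU imset_f.
have [b bR ab] := surj _ _ _ _ HT' tsp a aF.
by exists (j' b); rewrite // in_setU imset_f ?orbT.
Qed.

End PastedPolygons.

(** Isolated corners form whole vertices of both the surface and its cut. *)
Lemma isolated_closed (T : diagram) (F : {set side T}) :
    is_surface T -> (forall d : side T, strand d -> strand (opp d)) ->
    piece_closed (X := cut T) F ->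
  closed (@corner_rel T) [set d in F | isolated d].
Proof.
move=> T_surface sopp Fcl.
apply: (intro_closed (@same_vertexC T)) => x y xy; rewrite !inE.
case/andP=> xF iso; have vxy : same_vertex x y by apply: connect1.
rewrite -(isolatedE vxy) iso andbT -(closed_connect (corner_closed Fcl) (x := x)) //.
by rewrite -[connect _ _ _]in_vertex_cut vertex_cut_isolated // in_vertex.
Qed.

Section PastedWeight.
Variables (P T T' : diagram) (j : side T -> side P) (j' : side T' -> side P).
Hypotheses (HT : is_tangle T) (HT' : is_tangle T') (pst : pasting j j').
Let H := pasting_left pst.
Let H' := pasting_right pst.
Let tsp := pasting_sym pst.
Let P_surface := pasted_surface HT HT' pst.
Let P_strand := pasted_strand_opp HT HT' pst.
Implicit Types (F : {set side P}).

(** The isolated vertices of the pasted surface are those of the two pieces and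
    those created by pasting two boundary circles disjoint from the tangles. *)
Lemma card_isolated_root_pasted F : piece_closed (X := cut P) F ->
  #|[set d in F | isolated_root d]| =
  (#|[set a in j @^-1: F | isolated_root a]| +
   #|[set a in j' @^-1: F | isolated_root a]| + #|glued_circles j j' F|)%N.
Proof.
move=> Fcl; pose S := [set d in F | isolated d].
have Scl : closed (@corner_rel P) S by apply: isolated_closed.
have SE d x : same_vertex d x -> (d \in S) = (x \in S).
  by move=> dx; exact: (closed_connect Scl dx).
pose R (Q : diagram) (k : side Q -> side P) :=
  [set a in k @^-1: F | isolated_root a].
pose C := glued_circles j j' F.
have RS (Q Q' : diagram) (k : side Q -> side P) (k' : side Q' -> side P)
    (HQ : is_tangle Q) (ps : pasting k k') (a : side Q) : a \in R Q k -> isolated a /\ k a \in S.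
  rewrite !inE => /and3P[aF iso _]; rewrite aF iso.
  by rewrite (isolated_pasted HQ ps iso).
have CS a : a \in C -> [/\ glued j j' a, bdry a & j a \in S].
  rewrite !inE => /and3P[aF ga a0].
  by rewrite ga (glued_bdry pst ga) aF (isolated_glued HT HT' pst).
have cross (Q Q' : diagram) (k : side Q -> side P) (k' : side Q' -> side P)
    (HQ : is_tangle Q) (ps : pasting k k') (a : side Q) (b : side Q') :
    a \in R Q k -> same_vertex (k a) (k' b) -> False.
  move=> /(RS _ _ _ _ HQ ps)[iso _] /(same_vertex_isolated_pasted HQ ps iso)[c].
  by move/esym/(half_disjoint (pasting_left ps)).
have RR (Q Q' : diagram) (k : side Q -> side P) (k' : side Q' -> side P)
    (HQ : is_tangle Q) (ps : pasting k k') (a : side Q) (b : side Q) :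
    a \in R Q k -> b \in R Q k -> same_vertex (k a) (k b) -> a = b.
  move=> aR bR; have [iso _] := RS _ _ _ _ HQ ps _ aR.
  move=> /(same_vertex_isolated_pasted HQ ps iso)[c /(half_inj (pasting_left ps)) <-].
  move/(fingraph.rootP (@same_vertexC Q)).
  by move: aR bR; rewrite !inE => /and3P[_ _ /eqP->] /and3P[_ _ /eqP->].
have RC a b : a \in R T j -> b \in C -> same_vertex (j a) (j b) -> False.
  move=> /(RS _ _ _ _ HT pst)[iso _] /CS[_ bb _].
  move=> /(same_vertex_isolated_pasted HT pst iso)[c /(half_inj H) <-].
  by move=> /(isolated_strand iso); rewrite bb.
have root_surj (Q Q' : diagram) (k : side Q -> side P) (k' : side Q' -> side P)
    (HQ : is_tangle Q) (ps : pasting k k') (a : side Q) :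
    k a \in S -> (forall b, b \in vertex a -> ~~ glued k k' b) ->
    exists2 b, b \in R Q k & same_vertex (k a) (k b).
  move=> aS ung; pose r := fingraph.root (@corner_rel Q) a.
  have ar : same_vertex a r by apply: connect_root.
  have kr := same_vertex_pasted ps ar; exists r => //.
  have rr : r \in roots (@corner_rel Q) by apply: roots_root; apply: same_vertexC.
  have isoa : isolated a.
    by move: aS; rewrite inE (isolated_unglued HQ ps ung) => /andP[].
  rewrite inE /isolated_root rr -(isolatedE ar) isoa /= andbT inE.
  by move: aS; rewrite (SE _ _ kr) inE => /andP[].
rewrite -!/(R _ _) -/C.
have -> : #|[set d in F | isolated_root d]| = n_comp (@corner_rel P) S.
  by apply: eq_card => d; rewrite !inE /isolated_root andbA andbC inE.
rewrite (n_comp_transversal (B := j @: (R T j :|: C) :|: j' @: R T' j')) //.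
- rewrite (card_pasted_set pst) addnAC; congr (_ + _)%N; last first.
    by apply: eq_card => a; rewrite [in LHS]inE setUC (imset_pastedE tsp).
  rewrite -[RHS]subn0 -(cards0 (side T)) -(_ : R T j :&: C = set0) -?cardsU.
    by apply: eq_card => a; rewrite [in LHS]inE (imset_pastedE pst).
  apply/setP=> a; rewrite in_setI in_set0; apply/negP=> /andP[aR aC].
  by apply: RC aR aC _; apply: same_vertex_refl.
- exact: same_vertexC.
- apply/subsetP=> d /setUP[] /imsetP[a + ->].
    by case/setUP=> [/(RS _ _ _ _ HT pst)[] | /CS[]].
  by move/(RS _ _ _ _ HT' tsp)=> [].
- move=> x y xB yB xy; have yx : same_vertex y x by rewrite same_vertex_sym.
  move: xB yB xy yx => /setUP[] /imsetP[a + ->] /setUP[] /imsetP[b + ->].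
  + case/setUP=> aR /setUP[] bR ab ba.
    * by rewrite (RR _ _ _ _ HT pst a b).
    * by case: (RC a b).
    * by case: (RC b a).
    * have [[ga aa _] [gb bb _]] := (CS _ aR, CS _ bR).
      have := same_vertex_glued_pasted HT HT' pst ga ab.
      by move/(bdry_vertex_inj (tangle_surface HT) aa bb)->.
  + by move=> _ bR _ ba; case: (cross _ _ _ _ HT' tsp b a).
  + by move=> aR _ ab _; case: (cross _ _ _ _ HT' tsp a b).
  + by move=> aR bR ab _; rewrite (RR _ _ _ _ HT' tsp a b).
move=> x xS.
have glued_surj a : glued j j' a -> j a \in S -> j a \in j @: (R T j :|: C) :|: j' @: R T' j'.
  move=> ga; rewrite (imset_pastedE pst) in_setU !inE ga => /andP[->].
  by rewrite (isolated_glued HT HT' pst) // => ->; rewrite orbT.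
elim/(pasted_ind pst): x xS => a aS.
  case: (pickP [pred b in vertex a | glued j j' b]) => [b /andP[/=]|no].
    rewrite in_vertex => ab gb; have jab := same_vertex_pasted pst ab.
    by exists (j b) => //; apply: glued_surj; rewrite // -(SE _ _ jab).
  case: (root_surj _ _ _ _ HT pst a aS) => [b bv|b bR ab].
    by have := no b; rewrite /= bv /= => ->.
  by exists (j b); rewrite // in_setU imset_f // in_setU bR.
case: (pickP [pred b in vertex a | glued j' j b]) => [b /andP[/=]|no].
  rewrite in_vertex => ab gb; have jab := same_vertex_pasted tsp ab.
  have bS : j' b \in S by rewrite -(SE _ _ jab).
  case/gluedP: (gb) => c E; have [bb E'] := half_glued H' E.
  have [cb _] := half_glued H E'.
  have b0 : degree b == 0%N.
    by move: bS; rewrite inE (isolated_glued HT' HT tsp) // => /andP[].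
  have c0 : degree c == 0%N by rewrite (half_degree H E').
  have bc : same_vertex (j' b) (j c).
    rewrite -in_vertex (vertex_glued HT' HT tsp E) in_setU.
    by rewrite (is_tangle_degree0_bnext HT cb (eqP c0)) imset_f ?orbT ?vertex_refl.
  exists (j c); last exact: same_vertex_trans jab bc.
  by apply: glued_surj; rewrite ?(glued_partner pst E').1 // -(SE _ _ bc).
case: (root_surj _ _ _ _ HT' tsp a aS) => [b bv|b bR ab].
  by have := no b; rewrite /= bv /= => ->.
by exists (j' b); rewrite // in_setU imset_f ?orbT.
Qed.

Lemma card_glued_circles F : piece_closed (X := cut P) F ->
  #|glued_circles j j' F| = #|glued_circles j' j F|.
Proof.
move=> Fcl; rewrite -(card_imset _ (half_inj H)) -[RHS](card_imset _ (half_inj H')).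
rewrite -(card_imset _ (inv_inj P_surface.2)); apply: eq_card.
have sub (Q Q' : diagram) (k : side Q -> side P) (k' : side Q' -> side P)
    (HQ : is_tangle Q) (ps : pasting k k') (a : side Q) :
    a \in glued_circles k k' F -> opp (k a) \in k' @: glued_circles k' k F.
  rewrite inE => /and3P[aF ga a0]; case/gluedP: (ga) => a' E.
  rewrite E imset_f // inE (glued_partner ps E).2 -(half_degree (pasting_left ps) E) a0.
  have /negPf na : ~~ strand a.
    by apply: contraL (glued_bdry ps ga); apply: strand_interior.
  have := Fcl.2 (k a); rewrite opp_cut (half_strand (pasting_left ps)) na E aF.
  by move->.
move=> d; apply/imsetP/idP=> [[_ /imsetP[a aC ->] ->]|/imsetP[a aC ->]].
  exact: (sub _ _ _ _ HT pst).
by exists (opp (j' a)); [apply: (sub _ _ _ _ HT' tsp) | rewrite P_surface.2].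
Qed.

(** Sides, strands and polygons of the pieces are those of the whole. A boundary
    side on an arc weighs as much as a glued side, and those on circles disjoint
    from the tangles are traded, in pairs, for isolated vertices. *)
Lemma sum_side_weight_pasted F : piece_closed (X := cut P) F ->
  \sum_(d in F) side_weight d =
  \sum_(a in j @^-1: F) side_weight a + \sum_(a in j' @^-1: F) side_weight a.
Proof.
move=> Fcl; have circle (Q Q' : diagram) (k : side Q -> side P)
    (k' : side Q' -> side P) (HQ : is_tangle Q) (ps : pasting k k') :
    #|[set a in k @^-1: F | bdry a && (degree a == 0%N)]| =
    (#|k @^-1: [set d in F | bdry d && (degree d == 0%N)]| +
     #|glued_circles k k' F|)%N.
  have degE a : bdry a -> ~~ glued k k' a -> degree (k a) = degree a.
    move=> ba na; apply: (degree_unglued HQ ps) => b; rewrite in_vertex => ab.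
    apply: contra na => gb.
    by rewrite (bdry_vertex_inj (tangle_surface HQ) ba (glued_bdry ps gb) ab).
  rewrite -cardsUI [X in (_ + X)%N](_ : _ = 0%N) ?addn0; last first.
    apply: eq_card0 => a; rewrite !inE (bdry_pasted ps).
    by case: (glued _ _ a); rewrite ?andbF.
  apply: eq_card => a; rewrite !inE (bdry_pasted ps).
  case: (boolP (glued k k' a)) => ga; rewrite ?andbF ?orbF ?(glued_bdry ps ga) //=.
  by case: (boolP (bdry a)) => //= ba; rewrite degE.
have strandE (Q Q' : diagram) (k : side Q -> side P) (k' : side Q' -> side P)
    (ps : pasting k k') :
    #|k @^-1: [set d in F | strand d]| = #|[set a in k @^-1: F | strand a]|.
  by apply: eq_card => a; rewrite !inE (half_strand (pasting_left ps)).
rewrite /side_weight !big_split /= -!mulr_sumr !sum_bool_card !sumr_const.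
rewrite !mulNrn !natz card_isolated_root_pasted // (fcard_nxt_pasted HT HT' pst) //.
rewrite (card_pasted_set pst F) (card_pasted_set pst [set d in F | strand d]).
rewrite (card_pasted_set pst [set d in F | bdry d && _]).
rewrite (strandE _ _ _ _ pst) (strandE _ _ _ _ tsp).
rewrite (circle _ _ _ _ HT pst) (circle _ _ _ _ HT' tsp) -(card_glued_circles Fcl).
rewrite !PoszD; ring.
Qed.

End PastedWeight.

Local Close Scope ring_scope.

(** * Faces and holes of a pasted diagram *)

Section Faces.
Variable T : diagram.
Hypothesis T_cut : is_surface (cut T).
Implicit Types (d : side T) (f : face T).

Lemma face_of_eq d d' : (face_of d == face_of d') = (d' \in val (face_of d)).
Proof. by rewrite -val_eqE /= (component_eq T_cut). Qed.

Lemma face_of_surj f : exists d, face_of d == f.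
Proof.
by case/imsetP: (valP f) => d _ E; exists d; rewrite -val_eqE /= -E.
Qed.

Definition face_side f := xchoose (face_of_surj f).

Lemma face_sideK f : face_of (face_side f) = f.
Proof. exact/eqP/(xchooseP (face_of_surj f)). Qed.

Lemma mem_face f d : (d \in val f) = (face_of d == f).
Proof. by rewrite -{1}[f]face_sideK -face_of_eq face_sideK eq_sym. Qed.

Lemma face_closed f : piece_closed (X := cut T) (val f).
Proof. by rewrite -[f]face_sideK; apply: component_closed. Qed.

Lemma well_placedP :
  reflect (forall b c : side T, bdry b -> bdry c -> face_of b = face_of c -> b = c)
          (well_placed T).
Proof.
apply: (iffP forallP) => [wp b c bb bc E|wp f].
  have /card_le1_eqP := wp (face_of b); apply; rewrite inE mem_face ?bb ?E ?eqxx //.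
apply/card_le1_eqP => b c; rewrite !inE !mem_face => /andP[/eqP bf bb] /andP[/eqP cf bc].
by apply: wp; rewrite // bf.
Qed.

End Faces.

Lemma is_tangle_cut (T : diagram) : is_tangle T -> is_surface (cut T).
Proof. by case=> Ts so *; apply: cut_surface. Qed.

(** Either all the vertices of a hole are endpoints of the tangle, or none is. *)
Lemma endpoints_eq0 (T : diagram) (b : side T) : is_tangle T -> bdry b ->
  (endpoints b == 0) = (degree b == 0).
Proof.
move=> HT bb; case: (degree_bdry HT bb) => [E|[E hb]]; rewrite E /=.
  apply/negbTE; rewrite -lt0n /endpoints -has_count; apply/hasP.
  by exists b; rewrite ?E // /hole in_orbit.
have -> : endpoints b = count (fun c => degree c == 1) [:: b]; last by rewrite /= E.
by move: hb; rewrite /endpoints /hole size_orbit /orbit => ->.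
Qed.

Section PastedFaces.
Variables (P T T' : diagram) (j : side T -> side P) (j' : side T' -> side P).
Hypotheses (HT : is_tangle T) (HT' : is_tangle T') (pst : pasting j j').
Let H := pasting_left pst.
Let H' := pasting_right pst.
Let tsp := pasting_sym pst.
Let P_surface := pasted_surface HT HT' pst.
Let P_cut := cut_surface P_surface (pasted_strand_opp HT HT' pst).
Let T_cut := is_tangle_cut HT.
Implicit Types (a b d x : side T) (F : {set side P}).

Lemma pasted_cut_surface : is_surface (cut P).
Proof. exact: P_cut. Qed.

Lemma preimset_closed F :
  piece_closed (X := cut P) F -> piece_closed (X := cut T) (j @^-1: F).
Proof.
move=> [Fn Fo]; split=> a; rewrite ?nxt_cut ?opp_cut !inE.
  by have := Fn (j a); rewrite nxt_cut (half_nxt H).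
have := Fo (j a); rewrite opp_cut (half_strand H); case: ifP => // _.
case: (boolP (glued j j' a)) => [/(glued_bdry pst)/eqP-> //|na].
by rewrite (opp_unglued pst).
Qed.

(** Pasting merges faces but cuts none. *)
Lemma face_of_pasted a b : face_of a = face_of b -> face_of (j a) = face_of (j b).
Proof.
move/eqP; rewrite (face_of_eq T_cut) => ab; apply/eqP; rewrite (face_of_eq P_cut).
have aF : a \in j @^-1: component (X := cut P) (j a).
  by rewrite inE; apply: (@component_refl (cut P)).
have := @component_sub (cut T) a _ (preimset_closed (component_closed P_cut (j a))) aF.
by move/subsetP/(_ _ ab); rewrite inE.
Qed.

Hypothesis T_wp : well_placed T.

(** A face that meets the boundary away from the pasted holes is not affected by
    the pasting, since it meets the boundary only once. *)
Lemma face_unglued b (d : side P) : bdry b -> ~~ glued j j' b ->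
  d \in val (face_of (j b)) -> exists2 a, d = j a & face_of b = face_of a.
Proof.
move=> bb nb; pose C := val (face_of b).
have ung a : a \in C -> ~~ glued j j' a.
  rewrite (mem_face T_cut) => /eqP ab; apply: contra nb => ga.
  by rewrite -(well_placedP T_cut T_wp _ _ (glued_bdry pst ga) bb ab).
have [Cn Co] : piece_closed (X := cut T) C := face_closed T_cut (face_of b).
have jC a : (j a \in j @: C) = (a \in C) by rewrite mem_imset //; apply: half_inj H.
have j'C (a' : side T') : (j' a' \in j @: C) = false.
  by apply/imsetP=> -[c _ /esym/(half_disjoint H)].
have jCcl : piece_closed (X := cut P) (j @: C).
  split=> x; elim/(pasted_ind pst): x => a; rewrite ?nxt_cut ?opp_cut.
  - by rewrite (half_nxt H) !jC -(Cn a).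
  - by rewrite (half_nxt H') !j'C.
  - rewrite (half_strand H); case: ifP => // sa.
    case: (boolP (glued j j' a)) => [ga|na].
      case/gluedP: (ga) => a' ->; rewrite j'C jC; apply/esym.
      by apply: contraTF ga; apply: ung.
    by rewrite (opp_unglued pst) // !jC -(Co a) opp_cut sa.
  rewrite (half_strand H'); case: ifP => // sa.
  case: (boolP (glued j' j a)) => [/gluedP[c E]|na].
    rewrite E j'C jC; apply/negbTE; apply: contraL (glued_partner tsp E).2.
    exact: ung.
  by rewrite (opp_unglued tsp) // !j'C.
have bC : j b \in j @: C by rewrite jC; apply: (@component_refl (cut T)).
move/(subsetP (@component_sub (cut P) _ _ jCcl bC))/imsetP=> [a aC ->].
by exists a => //; apply/esym/eqP; rewrite -(mem_face T_cut).
Qed.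

Lemma face_of_unglued b a : bdry b -> ~~ glued j j' b ->
  (face_of (j a) == face_of (j b)) = (face_of a == face_of b).
Proof.
move=> bb nb; apply/eqP/eqP=> [/eqP|/face_of_pasted //].
rewrite -(mem_face P_cut) => /(face_unglued bb nb)[c /(half_inj H) <- //].
Qed.

Lemma face_of_unglued_other b (a' : side T') : bdry b -> ~~ glued j j' b ->
  (face_of (j' a') == face_of (j b)) = false.
Proof.
move=> bb nb; apply/negbTE/negP; rewrite -(mem_face P_cut).
by case/(face_unglued bb nb)=> c /esym/(half_disjoint H).
Qed.

Lemma bnext_pasted b : bdry b -> ~~ glued j j' b -> bnext (j b) = j (bnext b).
Proof.
move=> bb nb; apply: (bnextE P_surface); rewrite ?(bdry_pasted pst) ?bb //.
  by rewrite (glued_bnext HT pst) nb (bdry_bnext (tangle_surface HT)).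
rewrite (half_nxt H); apply: (same_vertex_pasted pst).
exact: (same_vertex_bnext (tangle_surface HT)).
Qed.

Lemma iter_bnext_pasted b i : bdry b -> ~~ glued j j' b ->
  iter i (@bnext P) (j b) = j (iter i (@bnext T) b).
Proof.
move=> bb nb; elim: i => //= i ->; apply: bnext_pasted.
  exact: (bdry_iter_bnext (tangle_surface HT)).
by elim: i => //= i; rewrite (glued_bnext HT pst).
Qed.

Lemma hole_pasted b : bdry b -> ~~ glued j j' b -> hole (j b) = map j (hole b).
Proof.
move=> bb nb; have iterE i := iter_bnext_pasted i bb nb.
have oE : order (@bnext P) (j b) = order (@bnext T) b.
  rewrite /order -(card_image (half_inj H)); apply: eq_card => d.
  apply/idP/imageP => [/iter_findex <-|[a /iter_findex <- ->]].
    by rewrite iterE; eexists; last by []; apply: fconnect_iter.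
  by rewrite -iterE -[_ \in _]/(fconnect _ _ _) fconnect_iter.
rewrite /hole /orbit oE; apply: (@eq_from_nth _ (j b)) => [|i].
  by rewrite size_map !size_traject.
rewrite size_traject => iT.
by rewrite (nth_map b) ?size_traject // !nth_traject.
Qed.

Lemma degree_unglued_bdry b :
  bdry b -> ~~ glued j j' b -> degree (j b) = degree b.
Proof.
move=> bb nb; apply: (degree_unglued HT pst) => a; rewrite in_vertex => ab.
apply: contra nb => ga.
by rewrite (bdry_vertex_inj (tangle_surface HT) bb (glued_bdry pst ga) ab).
Qed.

Lemma endpoints_pasted b :
  bdry b -> ~~ glued j j' b -> endpoints (j b) = endpoints b.
Proof.
move=> bb nb; rewrite /endpoints hole_pasted // count_map.
apply: eq_in_count => c; rewrite /hole -fconnect_orbit => /iter_findex <- /=.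
rewrite degree_unglued_bdry //; first exact: (bdry_iter_bnext (tangle_surface HT)).
by elim: (findex _ _ _) => //= i; rewrite (glued_bnext HT pst).
Qed.

Lemma endpoints_pasted_eq0 b : bdry (j b) ->
  (endpoints (j b) == 0) = (degree (j b) == 0).
Proof.
rewrite (bdry_pasted pst) => /andP[bb nb].
by rewrite endpoints_pasted // degree_unglued_bdry // endpoints_eq0.
Qed.

End PastedFaces.

Section PastedWellPlaced.
Variables (P T T' : diagram) (j : side T -> side P) (j' : side T' -> side P).
Hypotheses (HT : is_tangle T) (HT' : is_tangle T') (pst : pasting j j').
Hypotheses (wp : well_placed T) (wp' : well_placed T').

(** A face of the whole with a boundary side is a face of one of the pieces. *)
Lemma well_placed_pasted : well_placed P.
Proof.
have P_cut := pasted_cut_surface HT HT' pst.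
apply/(well_placedP P_cut) => x y bx by' /esym/eqP.
have half (Q Q' : diagram) (k : side Q -> side P) (k' : side Q' -> side P)
    (HQ : is_tangle Q) (HQ' : is_tangle Q') (ps : pasting k k')
    (wpQ : well_placed Q) (a : side Q) :
    bdry (k a) -> face_of y == face_of (k a) -> k a = y.
  rewrite (bdry_pasted ps) => /andP[ba na]; rewrite -(mem_face P_cut).
  move=> /(face_unglued HQ ps wpQ ba na)[c yc ac].
  rewrite yc; congr k; apply: (well_placedP (is_tangle_cut HQ) wpQ) ac => //.
  by move: by'; rewrite yc (bdry_pasted ps) => /andP[].
elim/(pasted_ind pst): x bx => a ba; first exact: (half _ _ _ _ HT HT' pst).
exact: (half _ _ _ _ HT' HT (pasting_sym pst)).
Qed.

Lemma pasted_endpoints_eq0 (b : side P) :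
  bdry b -> (endpoints b == 0) = (degree b == 0).
Proof.
elim/(pasted_ind pst): b => b; first exact: (endpoints_pasted_eq0 HT HT' pst).
exact: (endpoints_pasted_eq0 HT' HT (pasting_sym pst)).
Qed.

End PastedWellPlaced.

Local Open Scope ring_scope.

(** * Values of states under pasting *)

(** The label of a face of the piece is read at an arbitrary one of its sides; the
    choice is immaterial by [restrictE]. *)
Definition restrict (A : Type) (P T : diagram) (j : side T -> side P)
    (s : {ffun face P -> A}) : {ffun face T -> A} :=
  [ffun f => s (face_of (j (face_side f)))].

Lemma restrictE (A : Type) (P T T' : diagram) (j : side T -> side P)
    (j' : side T' -> side P) (s : {ffun face P -> A}) (a : side T) :
    is_tangle T -> is_tangle T' -> pasting j j' ->
  restrict j s (face_of a) = s (face_of (j a)).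
Proof.
move=> HT HT' pst; rewrite ffunE; congr (s _).
by apply: (face_of_pasted HT HT' pst); apply: face_sideK.
Qed.

Section Values.
Variables (R Rs : comUnitRingType) (W : weights R Rs).

Lemma sqrt_wt_unit (i : sym W) : sqrt_wt i \is a GRing.unit.
Proof.
by rewrite -(unitrX_pos _ (n := 2)) // sqrt_wtK rmorph_unit ?wt_unit.
Qed.

Lemma exprz_sum (I : Type) (r : seq I) (Q : pred I) (n : I -> int) (x : Rs) :
  x \is a GRing.unit -> x ^ (\sum_(i <- r | Q i) n i) = \prod_(i <- r | Q i) x ^ n i.
Proof.
move=> ux; apply: (big_morph (fun m : int => x ^ m)) => [m p|]; last exact: expr0z.
exact: exprzDr.
Qed.

Section FaceProduct.
Variable T : diagram.
Hypothesis T_surface : is_surface T.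
Hypothesis T_strand_opp : forall d : side T, strand d -> strand (opp d).
Hypothesis T_strand_interior : forall d : side T, strand d -> ~~ bdry d.
Hypothesis T_wp : well_placed T.
Hypothesis T_endpoints :
  forall b : side T, bdry b -> (endpoints b == 0) = (degree b == 0).
Let T_cut := cut_surface T_surface T_strand_opp.

(** By well-placedness, a face has at most one arc on the boundary, and the number
    of its arcs is exactly what [euler_cut] leaves over. *)
Lemma face_valueE (s : {ffun face T -> sym W}) (f : face T) :
  face_value s f = sqrt_wt (s f) ^ (\sum_(d in val f) side_weight d).
Proof.
pose B := [set d in val f | bdry d && (degree d != 0)].
have B1 : (#|B| <= 1)%N.
  apply: leq_trans (forallP T_wp f); apply: subset_leq_card.
  by apply/subsetP=> d; rewrite !inE => /and3P[-> ->].
have arcE : meets_arc f = (0 < #|B|)%N.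
  apply/exists_inP/card_gt0P => [[d df /andP[bd ed]]|[d]].
    by exists d; rewrite !inE df bd -T_endpoints // -lt0n.
  by rewrite !inE => /and3P[df bd ed]; exists d; rewrite // bd lt0n T_endpoints.
have ux := sqrt_wt_unit (s f).
rewrite /face_value arcE -sqrt_wtK exprnP exprz_exp.
rewrite -[X in _ ^ X](_ : 2 * euler_face f = _) //.
rewrite (euler_cut T_surface T_strand_opp T_strand_interior (face_closed T_cut f)) -/B.
case: #|B| B1 => [|[|//]] _ /=; first by rewrite divr1 addr0.
by rewrite exprzDr // expr1z mulrK.
Qed.

Lemma prod_face (g : side T -> face T -> Rs) :
  \prod_(f : face T) \prod_(d in val f) g d f = \prod_d g d (face_of d).
Proof.
rewrite [RHS](partition_big (@face_of T) xpredT) //=.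
apply: eq_bigr => f _; apply: eq_big => [d|d]; first by rewrite (mem_face T_cut).
by rewrite (mem_face T_cut) => /eqP->.
Qed.

Lemma prod_face_value (s : {ffun face T -> sym W}) :
  \prod_(f : face T) face_value s f = \prod_d sqrt_wt (s (face_of d)) ^ side_weight d.
Proof.
rewrite -(prod_face (fun d f => sqrt_wt (s f) ^ side_weight d)).
by apply: eq_bigr => f _; rewrite face_valueE exprz_sum // sqrt_wt_unit.
Qed.

End FaceProduct.

Section PastedValue.
Variables (P T T' : diagram) (j : side T -> side P) (j' : side T' -> side P).
Hypotheses (HT : is_tangle T) (HT' : is_tangle T') (pst : pasting j j').
Let H := pasting_left pst.
Let H' := pasting_right pst.
Let tsp := pasting_sym pst.
Let P_surface := pasted_surface HT HT' pst.
Implicit Types (s : {ffun face P -> sym W}).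

(** Both orders in which a crossing may list its two overpass branches give the
    same value, since a half-turn does not change the weight of a crossing. *)
Lemma crossing_value_pasted s (V : {set side T}) :
  crossing_value s (j @: V) = crossing_value (restrict j s) V.
Proof.
rewrite /crossing_value.
set B := [set t in V | _]; set Bj := [set t in j @: V | _].
have BjE : Bj = j @: B.
  apply/setP=> t; rewrite inE; apply/andP/imsetP=> [[/imsetP[a aV ->]]|[a + ->]].
    by rewrite (half_strand H) (half_over H) => ha; exists a; rewrite // inE aV.
  by rewrite inE (half_strand H) (half_over H) => /andP[aV ->]; rewrite imset_f.
have perm : perm_eq (enum Bj) (map j (enum B)).
  apply: uniq_perm; rewrite ?enum_uniq ?map_inj_uniq ?enum_uniq //.
    exact: half_inj H.
  move=> t; rewrite mem_enum BjE; apply/imsetP/mapP=> [] [a aB ->];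
    by exists a; rewrite // ?mem_enum // -mem_enum.
have strB t : t \in enum B -> strand t by rewrite mem_enum inE => /and3P[].
have := perm_size perm; rewrite size_map.
case: (enum B) (enum Bj) perm strB => [|t [|t' [|? ?]]] [|u [|u' [|? ?]]] //= perm strB _.
have st : strand t by apply: strB; rewrite inE eqxx.
have st' : strand t' by apply: strB; rewrite !inE eqxx orbT.
rewrite !(restrictE _ _ HT HT' pst) -!(opp_pasted_strand HT pst) //.
have tailE x y z : perm_eq [:: x; y] [:: x; z] -> y = z.
  by rewrite perm_cons => /perm_mem/(_ y); rewrite !inE eqxx => /esym/eqP.
have := perm_mem perm u; rewrite !inE eqxx /= => /esym/orP[]/eqP uE.
  by move: perm; rewrite uE => /tailE->.
move: perm; rewrite uE perm_sym -[[:: j t; _]]/([:: j t] ++ [:: j t']).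
by rewrite perm_catC perm_sym => /tailE->; rewrite cwt_rot.
Qed.

Lemma degree4_unglued (d a : side T) :
  degree (j d) = 4 \/ degree d = 4 -> a \in vertex d -> ~~ glued j j' a.
Proof.
rewrite in_vertex => d4 da; apply/negP=> ga; case: d4.
  rewrite (degreeE (same_vertex_pasted pst da)).
  by have := degree_glued HT HT' pst ga; case: (degree _) => [|[|[]]].
rewrite (degreeE da).
by have := is_tangle_degree_le1 HT (glued_bdry pst ga); case: (degree _) => [|[]].
Qed.

End PastedValue.

Section PastedProduct.
Variables (P T T' : diagram) (j : side T -> side P) (j' : side T' -> side P).
Hypotheses (HT : is_tangle T) (HT' : is_tangle T') (pst : pasting j j').
Let H := pasting_left pst.
Let H' := pasting_right pst.
Let tsp := pasting_sym pst.
Let P_surface := pasted_surface HT HT' pst.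
Implicit Types (s : {ffun face P -> sym W}).

Definition pasted_crossings (Q : diagram) (k : side Q -> side P) :=
  [set k @: V | V : {set side Q} in crossings Q].

(** A vertex on the pasted holes carries at most one strand of each piece, hence
    pasting creates no crossing. *)
Lemma crossings_pasted :
  crossings P = pasted_crossings j :|: pasted_crossings j'.
Proof.
apply/setP=> V; rewrite in_setU; apply/imsetP/orP.
  case=> d; rewrite inE => + ->; elim/(pasted_ind pst): d => d /eqP d4; [left|right].
    have ung := degree4_unglued HT HT' pst (or_introl d4).
    rewrite (vertex_unglued HT pst) // imset_f // imset_f // inE.
    by rewrite -(degree_unglued HT pst) // d4.
  have ung := degree4_unglued HT' HT tsp (or_introl d4).
  rewrite (vertex_unglued HT' tsp) // imset_f // imset_f // inE.
  by rewrite -(degree_unglued HT' tsp) // d4.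
case=> /imsetP[_ /imsetP[d + ->] ->]; rewrite inE => /eqP d4.
  have ung := degree4_unglued HT HT' pst (or_intror d4); exists (j d).
    by rewrite inE (degree_unglued HT pst) // d4.
  by rewrite (vertex_unglued HT pst).
have ung := degree4_unglued HT' HT tsp (or_intror d4); exists (j' d).
  by rewrite inE (degree_unglued HT' tsp) // d4.
by rewrite (vertex_unglued HT' tsp).
Qed.

Lemma prod_crossings_pasted (g : {set side P} -> Rs) :
  \prod_(V in crossings P) g V =
  (\prod_(V in crossings T) g (j @: V)) * (\prod_(V in crossings T') g (j' @: V)).
Proof.
have dis : [disjoint pasted_crossings j & pasted_crossings j'].
  apply/pred0P=> V /=; apply/negP=> /andP[/imsetP[_ /imsetP[d _ ->] ->]].
  case/imsetP=> V' _ /setP/(_ (j d)); rewrite imset_f ?vertex_refl // => /esym.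
  by case/imsetP=> d' _ /(half_disjoint H).
rewrite crossings_pasted (eq_bigl [predU pasted_crossings j & pasted_crossings j']).
  rewrite bigU //; congr (_ * _); rewrite big_imset // => V V' _ _.
    exact: (imset_inj (half_inj H)).
  exact: (imset_inj (half_inj H')).
by move=> V; rewrite in_setU.
Qed.

(** Adjacencies and crossings split between the two pieces, and so do the exponents
    of the face factors, by [sum_side_weight_pasted]. *)
Lemma value_pasted s : well_placed T -> well_placed T' ->
  value s = value (restrict j s) * value (restrict j' s).
Proof.
move=> wp wp'; rewrite /value.
have -> : forbidden_state s =
    forbidden_state (restrict j s) || forbidden_state (restrict j' s).
  have half (Q Q' : diagram) (k : side Q -> side P) (k' : side Q' -> side P)
      (HQ : is_tangle Q) (HQ' : is_tangle Q') (ps : pasting k k') (t : side Q) :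
      strand (k t) && forbidden (s (face_of (k t))) (s (face_of (opp (k t)))) =
      strand t && forbidden (restrict k s (face_of t)) (restrict k s (face_of (opp t))).
    rewrite (half_strand (pasting_left ps)) !(restrictE _ _ HQ HQ' ps).
    by case: (boolP (strand t)) => //= st; rewrite (opp_pasted_strand HQ ps).
  apply/existsP/orP=> [[t]|].
    elim/(pasted_ind pst): t => t; rewrite ?(half _ _ _ _ HT HT' pst);
      rewrite ?(half _ _ _ _ HT' HT tsp) => ft; [left|right]; apply/existsP;
      by exists t.
  case=> /existsP[t ft]; [exists (j t)|exists (j' t)].
    by rewrite (half _ _ _ _ HT HT' pst).
  by rewrite (half _ _ _ _ HT' HT tsp).
case: (forbidden_state _); first by rewrite mul0r.
case: (forbidden_state _); first by rewrite mulr0.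
rewrite mulrACA; congr (_ * _).
  have wpP := well_placed_pasted HT HT' pst wp wp'.
  rewrite (prod_face_value (tangle_surface HT) (strand_opp HT)
    (strand_interior HT) wp (fun b => endpoints_eq0 HT (b := b))).
  rewrite (prod_face_value (tangle_surface HT') (strand_opp HT')
    (strand_interior HT') wp' (fun b => endpoints_eq0 HT' (b := b))).
  have P_cut := pasted_cut_surface HT HT' pst.
  have half (Q Q' : diagram) (k : side Q -> side P) (k' : side Q' -> side P)
      (HQ : is_tangle Q) (HQ' : is_tangle Q') (ps : pasting k k') :
      \prod_a sqrt_wt (restrict k s (face_of a)) ^ side_weight a =
      \prod_(F : face P) sqrt_wt (s F) ^ (\sum_(a in k @^-1: val F) side_weight a).
    rewrite (partition_big (fun a => face_of (k a)) xpredT) //=.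
    apply: eq_bigr => F _; rewrite exprz_sum ?sqrt_wt_unit //.
    apply: eq_big => [a|a /eqP <-]; first by rewrite inE (mem_face P_cut).
    by rewrite (restrictE _ _ HQ HQ' ps).
  rewrite (half _ _ _ _ HT HT' pst) (half _ _ _ _ HT' HT tsp) -big_split /=.
  apply: eq_bigr => F _.
  rewrite (face_valueE P_surface (pasted_strand_opp HT HT' pst)
    (pasted_strand_interior HT HT' pst) wpP (pasted_endpoints_eq0 HT HT' pst)).
  rewrite (sum_side_weight_pasted HT HT' pst) ?exprzDr ?sqrt_wt_unit //.
  exact: face_closed.
rewrite prod_crossings_pasted; congr (_ * _); apply: eq_bigr => V _.
  by rewrite (crossing_value_pasted HT HT' pst).
by rewrite (crossing_value_pasted HT' HT tsp).
Qed.

End PastedProduct.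
End Values.

(** * States of a pasted diagram *)

Section FaceMoves.
Variable T : diagram.
Hypothesis T_cut : is_surface (cut T).

Lemma face_of_nxt (d : side T) : face_of (nxt d) = face_of d.
Proof.
by apply/eqP; rewrite -(mem_face T_cut) (face_closed T_cut (face_of d)).1 (@component_refl (cut T)).
Qed.

Lemma face_of_opp (d : side T) : ~~ strand d -> face_of (opp d) = face_of d.
Proof.
move=> /negPf sd; apply/eqP; rewrite -(mem_face T_cut).
have := (face_closed T_cut (face_of d)).2 d; rewrite opp_cut sd => ->.
exact: (@component_refl (cut T)).
Qed.

End FaceMoves.

Section PastedStates.
Variables (P T T' : diagram) (j : side T -> side P) (j' : side T' -> side P).
Hypotheses (HT : is_tangle T) (HT' : is_tangle T') (pst : pasting j j').
Let H := pasting_left pst.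
Let H' := pasting_right pst.
Let tsp := pasting_sym pst.
Let T_cut := is_tangle_cut HT.
Let T'_cut := is_tangle_cut HT'.
Let P_cut := pasted_cut_surface HT HT' pst.

Lemma glued_strand (a : side T) : glued j j' a -> ~~ strand a.
Proof. by move/(glued_bdry pst); apply: contraL; apply: strand_interior. Qed.

Definition agree (A : eqType) (s1 : {ffun face T -> A}) (s2 : {ffun face T' -> A}) :=
  [forall a, forall a', (opp (j a) == j' a') ==> (s1 (face_of a) == s2 (face_of a'))].

Lemma agreeP (A : eqType) (s1 : {ffun face T -> A}) (s2 : {ffun face T' -> A}) :
  reflect (forall a a', opp (j a) = j' a' -> s1 (face_of a) = s2 (face_of a'))
          (agree s1 s2).
Proof.
apply: (iffP forallP) => [h a a' E|h a].
  by move/forallP/(_ a')/implyP: (h a); rewrite E eqxx => /(_ isT)/eqP.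
by apply/forallP=> a'; apply/implyP=> /eqP E; apply/eqP/h.
Qed.

Lemma agree_restrict (A : eqType) (s : {ffun face P -> A}) :
  agree (restrict j s) (restrict j' s).
Proof.
apply/agreeP=> a a' E; rewrite (restrictE _ _ HT HT' pst) (restrictE _ _ HT' HT tsp).
congr (s _); rewrite -E (face_of_opp P_cut) // (half_strand H).
exact: glued_strand (glued_partner pst E).1.
Qed.

Lemma restrict_inj (A : eqType) :
  injective (fun s : {ffun face P -> A} => (restrict j s, restrict j' s)).
Proof.
move=> s1 s2 [/ffunP E /ffunP E']; apply/ffunP=> F; rewrite -(face_sideK F).
elim/(pasted_ind pst): (face_side F) => a.
  by have := E (face_of a); rewrite !(restrictE _ _ HT HT' pst).
by have := E' (face_of a); rewrite !(restrictE _ _ HT' HT tsp).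
Qed.

(** For each symbol x, the sides labelled x by either labelling form a union of
    components of the cut surface; hence each face lies in one such union. *)
Lemma restrict_surj (A : eqType) (s1 : {ffun face T -> A}) (s2 : {ffun face T' -> A}) :
  agree s1 s2 -> exists s, restrict j s = s1 /\ restrict j' s = s2.
Proof.
move/agreeP=> agr.
pose C x := j @: [set a | s1 (face_of a) == x] :|: j' @: [set a | s2 (face_of a) == x].
have jC x a : (j a \in C x) = (s1 (face_of a) == x).
  by rewrite (imset_pastedE pst) inE.
have j'C x a : (j' a \in C x) = (s2 (face_of a) == x).
  by rewrite /C setUC (imset_pastedE tsp) inE.
have Ccl x : piece_closed (X := cut P) (C x).
  split=> d; elim/(pasted_ind pst): d => a; rewrite ?nxt_cut ?opp_cut.
  - by rewrite (half_nxt H) !jC (face_of_nxt T_cut).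
  - by rewrite (half_nxt H') !j'C (face_of_nxt T'_cut).
  - rewrite (half_strand H); case: (boolP (strand a)) => // sa.
    case: (boolP (glued j j' a)) => [/gluedP[a' E]|na].
      by rewrite E j'C jC (agr _ _ E).
    by rewrite (opp_unglued pst) // !jC (face_of_opp T_cut).
  rewrite (half_strand H'); case: (boolP (strand a)) => // sa.
  case: (boolP (glued j' j a)) => [/gluedP[c E]|na].
    by have [_ E'] := half_glued H' E; rewrite E j'C jC (agr _ _ E').
  by rewrite (opp_unglued tsp) // !j'C (face_of_opp T'_cut).
have label (F : face P) : exists x, val F \subset C x.
  have [x dC] : exists x, face_side F \in C x.
    elim/(pasted_ind pst): (face_side F) => a.
      by exists (s1 (face_of a)); rewrite jC.
    by exists (s2 (face_of a)); rewrite j'C.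
  by exists x; rewrite -[F]face_sideK; apply: (@component_sub (cut P)).
have [s sE] := fin_all_exists label.
have faceC d : d \in C (s (face_of d)).
  by apply: (subsetP (sE (face_of d))); apply: (@component_refl (cut P)).
exists [ffun F => s F]; split; apply/ffunP=> f; rewrite -[f]face_sideK.
  by rewrite (restrictE _ _ HT HT' pst) ffunE; apply/esym/eqP; rewrite -jC.
by rewrite (restrictE _ _ HT' HT tsp) ffunE; apply/esym/eqP; rewrite -j'C.
Qed.

(** Labels that agree across the pasted sides extend to the merged faces, in a
    single way. *)
Lemma sum_states_pasted (A : finType) (V : nmodType)
    (g : {ffun face T -> A} -> {ffun face T' -> A} -> V) :
  \sum_(s : {ffun face P -> A}) g (restrict j s) (restrict j' s) =
  \sum_(p : {ffun face T -> A} * {ffun face T' -> A} | agree p.1 p.2) g p.1 p.2.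
Proof.
pose h (s : {ffun face P -> A}) := (restrict j s, restrict j' s).
rewrite -(big_imset (h := h) (A := predT) (fun p => g p.1 p.2)) /=; last first.
  by move=> s1 s2 _ _; apply: restrict_inj.
apply: eq_bigl => p; apply/imsetP/idP => [[s _ ->]|]; first exact: agree_restrict.
by case: p => s1 s2 /restrict_surj[s [E E']]; exists s; rewrite // /h E E'.
Qed.

Lemma extends_pasted (R Rs : comUnitRingType) (W : weights R Rs)
    (s : {ffun face P -> sym W}) arcs w :
  extends s (map j arcs) w = extends (restrict j s) arcs w.
Proof.
rewrite /extends -map_comp; congr (_ == w); apply: eq_map => a /=.
by rewrite (restrictE _ _ HT HT' pst).
Qed.

(** The faces meeting an unpasted hole and their mutual adjacencies are the same
    before and after pasting, and so are the partial states on them. *)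
Lemma admissible_pasted (R Rs : comUnitRingType) (W : weights R Rs)
    (arcs : seq (side T)) (w : seq (sym W)) :
    well_placed T -> {in arcs, forall a, bdry a && ~~ glued j j' a} ->
  admissible (map j arcs) w = admissible arcs w.
Proof.
move=> wp arcsP.
have arcE a f : a \in arcs -> (j a \in val (face_of (j (face_side f)))) = (a \in val f).
  move=> /arcsP/andP[ba na]; rewrite (mem_face P_cut) (mem_face T_cut).
  by rewrite eq_sym (face_of_unglued HT HT' pst wp) // face_sideK eq_sym.
have hasE f : has (fun a => a \in val (face_of (j (face_side f)))) (map j arcs) =
    has (fun a => a \in val f) arcs.
  by rewrite has_map; apply: eq_in_has => a aA /=; rewrite arcE.
apply/existsP/existsP=> [[p /and3P[/forallP pp pf pw]]|[q /and3P[/forallP qp qf qw]]].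
  exists (restrict j p); apply/and3P; split.
  - by apply/forallP=> f; rewrite ffunE -hasE.
  - apply: contra pf => /existsP[t /andP[st]]; rewrite !(restrictE _ _ HT HT' pst) => ft.
    by apply/existsP; exists (j t); rewrite (half_strand H) st (opp_pasted_strand HT pst).
  - rewrite -(eqP pw) -map_comp; apply/eqP/eq_map => a /=.
    by rewrite (restrictE _ _ HT HT' pst).
have memE a b : b \in arcs ->
    (b \in val (face_of a)) = (j b \in val (face_of (j a))).
  move=> /arcsP/andP[bb nb]; rewrite (mem_face P_cut) (mem_face T_cut) eq_sym.
  by rewrite -(face_of_unglued HT HT' pst wp) // eq_sym.
have mem'E a b : b \in arcs -> (j b \in val (face_of (j' a))) = false.
  move=> /arcsP/andP[bb nb].
  by rewrite (mem_face P_cut) eq_sym (face_of_unglued_other HT HT' pst wp).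
pose p : {ffun face P -> option (sym W)} := [ffun F : face P =>
  if [pick a | (a \in arcs) && (j a \in val F)] is Some a then q (face_of a) else None].
have pE a : p (face_of (j a)) = q (face_of a).
  rewrite ffunE; case: pickP => [b /andP[bA]|no].
    by rewrite -memE // (mem_face T_cut) => /eqP->.
  have := qp (face_of a); case: hasP => [[b bA]|_]; last by case: (q _).
  by rewrite memE // => jb; case/negP: (negbT (no b)); apply/andP.
have p'E a : p (face_of (j' a)) = None.
  rewrite ffunE; case: pickP => [b /andP[bA]|//].
  by rewrite mem'E.
exists p; apply/and3P; split.
- apply/forallP=> F; rewrite -[F]face_sideK.
  elim/(pasted_ind pst): (face_side F) => a.
    rewrite pE (eqP (qp (face_of a))) has_map; apply/eqP/eq_in_has => b bA.
    exact: memE.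
  rewrite p'E has_map; apply/eqP/esym/hasPn => b bA.
  by rewrite -[X in ~~ X]/(j b \in val (face_of (j' a))) mem'E.
- apply: contra qf => /existsP[t]; elim/(pasted_ind pst): t => t /andP[].
    rewrite (half_strand H) => st; rewrite (opp_pasted_strand HT pst) // !pE => ft.
    by apply/existsP; exists t; rewrite st.
  by rewrite p'E.
rewrite -(eqP qw) -map_comp; apply/eqP/eq_map => a /=; exact: pE.
Qed.

Lemma boundary_states_pasted (R Rs : comUnitRingType) (W : weights R Rs) arcs :
    well_placed T -> {in arcs, forall a, bdry a && ~~ glued j j' a} ->
  boundary_states W (map j arcs) = boundary_states W arcs.
Proof.
move=> wp arcsP; rewrite /boundary_states size_map.
by apply: eq_filter => w; apply: admissible_pasted.
Qed.

End PastedStates.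

(** * Evaluation matrices *)

Section IndexedMatrices.
Variables (S : pzSemiRingType) (I : eqType).
Implicit Types A B : indexed_mx S I.

Lemma entryE A (i : 'I_(size (rows A))) (k : 'I_(size (cols A))) :
    uniq (rows A) -> uniq (cols A) ->
  entry A (tnth (in_tuple (rows A)) i) (tnth (in_tuple (cols A)) k) = entries A i k.
Proof.
move=> ur uc; have idx (s : seq I) (n : 'I_(size s)) :
    uniq s -> index (tnth (in_tuple s) n) s = n.
  by move=> us; rewrite (tnth_nth (tnth (in_tuple s) n)) index_uniq.
rewrite /entry !idx //; case: insubP => [i' _ Ei|]; last by rewrite ltn_ord.
case: insubP => [k' _ Ek|]; last by rewrite ltn_ord.
by congr (entries A _ _); apply: val_inj.
Qed.

Lemma entry_default A (r c : I) :
  (r \notin rows A) || (c \notin cols A) -> entry A r c = 0.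
Proof.
rewrite /entry; case: insubP => // i; case: insubP => // k.
by rewrite !index_mem => -> _ ->.
Qed.

Lemma indexed_mx_eq A B :
    rows A = rows B -> cols A = cols B -> uniq (rows A) -> uniq (cols A) ->
    (forall r c, r \in rows A -> c \in cols A -> entry A r c = entry B r c) ->
  A = B.
Proof.
case: A B => [rs cs M] [rs' cs' N] /= Er Ec; subst rs' cs' => ur uc E.
congr IndexedMx; apply/matrixP=> i k.
have := E _ _ (mem_tnth i (in_tuple rs)) (mem_tnth k (in_tuple cs)).
by rewrite (@entryE (IndexedMx M)) // (@entryE (IndexedMx N)).
Qed.

Lemma entry_mul_indexed A B r c :
    uniq (rows A) -> uniq (cols B) -> r \in rows A -> c \in cols B ->
  entry (mul_indexed A B) r c =
    \sum_(m <- undup (cols A ++ rows B)) entry A r m * entry B m c.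
Proof.
move=> ur uc rA cB; have /tnthP[i ->] : r \in in_tuple (rows A) by [].
have /tnthP[k ->] : c \in in_tuple (cols B) by [].
rewrite (@entryE (mul_indexed A B)) //= mxE.
by rewrite [RHS]big_tnth; apply: eq_bigr => m _; rewrite !mxE.
Qed.

End IndexedMatrices.

Section StateSums.
Variables (R Rs : comUnitRingType) (W : weights R Rs) (T : diagram).
Implicit Types (s : {ffun face T -> sym W}) (r c w : seq (sym W)).

Definition boundary_word s (arcs : seq (side T)) := [seq s (face_of a) | a <- arcs].

Definition state_sum r c : Rs :=
  \sum_(s | extends s (lower_arcs T) r && extends s (upper_arcs T) c) value s.

Lemma boundary_states_uniq arcs : uniq (boundary_states W (T := T) arcs).
Proof. by rewrite filter_uniq // map_inj_uniq ?enum_uniq //; apply: val_inj. Qed.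

(** A partial state sees only some of the adjacencies of the full state. *)
Lemma boundary_word_state s arcs :
  ~~ forbidden_state s -> boundary_word s arcs \in boundary_states W arcs.
Proof.
move=> sf; rewrite mem_filter; apply/andP; split; last first.
  have sz : size (boundary_word s arcs) == size arcs by rewrite size_map.
  by apply/mapP; exists (Tuple sz); rewrite ?mem_enum.
apply/existsP; exists [ffun f : face T =>
  if has (fun a => a \in val f) arcs then Some (s f) else None].
apply/and3P; split.
- by apply/forallP=> f; rewrite ffunE; case: ifP.
- apply: contra sf => /existsP[t /andP[st]]; rewrite !ffunE.
  by do 2![case: ifP => // _]; move=> ft; apply/existsP; exists t; rewrite st.
rewrite -map_comp; apply/eqP/eq_in_map => a aA /=; rewrite ffunE.
case: hasP => // -[]; exists a => //; exact: (@component_refl (cut T)).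
Qed.

Lemma value_not_state s arcs :
  boundary_word s arcs \notin boundary_states W arcs -> value s = 0.
Proof.
by rewrite /value; case: ifP => // /negbT/(boundary_word_state arcs)->.
Qed.

(** Restricting rows and columns to the admissible words loses nothing, as the
    states extending any other word are forbidden. *)
Lemma entry_evaluation r c : entry (evaluation W T) r c = state_sum r c.
Proof.
have [rL|rL] := boolP (r \in Lambda W T); last first.
  rewrite entry_default ?rL //; apply/esym/big1 => s /andP[/eqP E _].
  by apply: (@value_not_state s (lower_arcs T)); rewrite /boundary_word E.
have [cU|cU] := boolP (c \in Upsilon W T); last first.
  rewrite entry_default ?cU ?orbT //; apply/esym/big1 => s /andP[_ /eqP E].
  by apply: (@value_not_state s (upper_arcs T)); rewrite /boundary_word E.
have /tnthP[i ->] : r \in in_tuple (Lambda W T) by [].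
have /tnthP[k ->] : c \in in_tuple (Upsilon W T) by [].
rewrite (@entryE _ _ (evaluation W T)) ?boundary_states_uniq //.
by rewrite mxE.
Qed.

End StateSums.

Section PastedEvaluation.
Variables (R Rs : comUnitRingType) (W : weights R Rs).
Variables (P T T' : diagram) (j : side T -> side P) (j' : side T' -> side P).
Hypotheses (HT : is_tangle T) (HT' : is_tangle T') (pst : pasting j j').
Hypotheses (wp : well_placed T) (wp' : well_placed T').
Hypothesis upper_pasted : upper_arcs P = map j (upper_arcs T).
Hypothesis lower_pasted : lower_arcs P = map j' (lower_arcs T').
Hypothesis upper_unglued :
  {in upper_arcs T, forall a, bdry a && ~~ glued j j' a}.
Hypothesis lower_unglued :
  {in lower_arcs T', forall a, bdry a && ~~ glued j' j a}.
Hypothesis agree_words : forall (s : {ffun face T -> sym W}) s',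
  agree j j' s s' = (boundary_word s (lower_arcs T) == boundary_word s' (upper_arcs T')).

(** Each pair of agreeing states is counted for one middle word, the one that both
    induce on the pasted holes. This word occurs among the indices unless the
    first state is forbidden, in which case the pair contributes zero. *)
Lemma state_sum_pasted (mid : seq (seq (sym W))) r c :
    uniq mid -> {subset Lambda W T <= mid} ->
  state_sum P r c = \sum_(m <- mid) state_sum T' r m * state_sum T m c.
Proof.
move=> um sub; pose St := {ffun face T -> sym W}; pose St' := {ffun face T' -> sym W}.
pose ext (s : St) (s' : St') :=
  extends s' (lower_arcs T') r && extends s (upper_arcs T) c.
pose g (s : St) (s' : St') := if ext s s' then value s * value s' else 0.
have -> : state_sum P r c = \sum_(p : St * St' | agree j j' p.1 p.2) g p.1 p.2.
  rewrite -(sum_states_pasted HT HT' pst) /state_sum big_mkcond /=.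
  apply: eq_bigr => s _; rewrite lower_pasted upper_pasted.
  rewrite (extends_pasted HT' HT (pasting_sym pst)) (extends_pasted HT HT' pst).
  by rewrite /g /ext; case: ifP => // _; apply: (value_pasted HT HT' pst).
pose low (s : St) := boundary_word s (lower_arcs T).
pose up' (s' : St') := boundary_word s' (upper_arcs T').
have -> : \sum_(m <- mid) state_sum T' r m * state_sum T m c =
    \sum_(m <- mid) \sum_(p : St * St' | (low p.1 == m) && (up' p.2 == m)) g p.1 p.2.
  apply: eq_bigr => m _; rewrite mulrC /state_sum big_distrlr pair_big /=.
  rewrite big_mkcond [RHS]big_mkcond /=; apply: eq_bigr => -[s s'] _ /=.
  rewrite /g /ext /extends -/(low s) -/(up' s').
  by do 2![case: (_ == m)] => /=; rewrite ?andbT ?andbF // andbC.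
rewrite (exchange_big_dep xpredT) //= big_mkcond; apply: eq_bigr => -[s s'] _ /=.
rewrite agree_words -/(low s) -/(up' s').
case: eqP => [<-|ne]; last first.
  by apply/esym/big1 => m /andP[/eqP <- /eqP E]; case: ne.
rewrite (eq_bigl (pred1 (low s))); last first.
  by move=> m; rewrite andbb /= eq_sym.
have [lm|lm] := boolP (low s \in mid).
  by rewrite -big_filter filter_pred1_uniq // big_seq1.
rewrite big1_seq => [|m /andP[/= /eqP->]]; last by rewrite (negPf lm).
rewrite /g; case: ifP => // _.
by rewrite (@value_not_state _ _ _ _ s (lower_arcs T)) ?mul0r //; apply: contra lm => /sub.
Qed.

Lemma evaluation_pasted :
  evaluation W P = mul_indexed (evaluation W T') (evaluation W T).
Proof.
have rE : Lambda W P = Lambda W T'.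
  rewrite /Lambda lower_pasted.
  exact: (boundary_states_pasted HT' HT (pasting_sym pst)).
have cE : Upsilon W P = Upsilon W T.
  by rewrite /Upsilon upper_pasted (boundary_states_pasted HT HT' pst).
apply: indexed_mx_eq => //; try exact: boundary_states_uniq.
move=> r c; rewrite [rows _]rE [cols _]cE => rL cU.
rewrite entry_mul_indexed //; try exact: boundary_states_uniq.
rewrite entry_evaluation.
rewrite (@state_sum_pasted (undup (Upsilon W T' ++ Lambda W T))) ?undup_uniq //.
  by apply: eq_bigr => m _; rewrite !entry_evaluation.
by move=> m mL; rewrite mem_undup mem_cat mL orbT.
Qed.

End PastedEvaluation.

Local Close Scope ring_scope.

(** * The composite of two tangles *)

Section Zip.
Variables (A B : eqType).
Implicit Types (s : seq A) (t : seq B).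

Lemma zip_mem s t x y : (x, y) \in zip s t -> x \in s /\ y \in t.
Proof.
elim: s t => [|u s IHs] [|v t] //=; rewrite !inE xpair_eqE.
by case/orP=> [/andP[/eqP-> /eqP->]|/IHs[-> ->]]; rewrite ?eqxx ?orbT.
Qed.

Lemma zip_memC s t x y : ((x, y) \in zip s t) = ((y, x) \in zip t s).
Proof.
by elim: s t => [|u s IHs] [|v t] //=; rewrite !inE !xpair_eqE andbC IHs.
Qed.

Lemma partnerP s t x y :
  uniq s -> size s = size t -> (partner s t x = Some y <-> (x, y) \in zip s t).
Proof.
rewrite /partner; elim: s t => [|u s IHs] [|v t] //= /andP[us uns] [sz].
rewrite inE xpair_eqE; case: (eqVneq u x) => [<-|ux] /=.
  split=> [[->]|/orP[/eqP-> //|/zip_mem[su _]]]; first by rewrite eqxx.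
  by move: us; rewrite su.
exact: IHs.
Qed.

Lemma eq_map_zip (C : eqType) (f : A -> C) (g : B -> C) s t :
  size s = size t ->
  (map f s == map g t) = all (fun p => f p.1 == g p.2) (zip s t).
Proof.
by elim: s t => [|u s IHs] [|v t] //= [/IHs <-]; rewrite eqseq_cons.
Qed.

Lemma size_flatten_zip (A' B' : eqType) (f : A -> seq A') (g : B -> seq B') s t :
    size s = size t -> {in zip s t, forall p, size (f p.1) = size (g p.2)} ->
  size (flatten (map f s)) = size (flatten (map g t)).
Proof.
elim: s t => [|u s IHs] [|v t] //= [sz] E; rewrite !size_cat.
rewrite (E (u, v)) ?mem_head // (IHs t) // => p pz.
by apply: E; rewrite inE pz orbT.
Qed.

Lemma zip_flattenP (A' B' : eqType) (f : A -> seq A') (g : B -> seq B') s t x y :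
    size s = size t -> {in zip s t, forall p, size (f p.1) = size (g p.2)} ->
  (x, y) \in zip (flatten (map f s)) (flatten (map g t)) <->
  exists2 p, p \in zip s t & (x, y) \in zip (f p.1) (g p.2).
Proof.
elim: s t => [|u s IHs] [|v t] //=; first by split=> // -[].
move=> [sz] E.
have Euv := E (u, v) (mem_head _ _); rewrite zip_cat // mem_cat.
have {}IHs := IHs t sz (fun p pz => E p (mem_behead (s := (u, v) :: _) pz)).
split=> [/orP[xy|/IHs[p pz xy]]|[p + xy]].
- by exists (u, v); rewrite ?mem_head.
- by exists p; rewrite // inE pz orbT.
rewrite inE => /orP[/eqP pE|pz]; first by move: xy; rewrite pE /= => ->.
by apply/orP; right; apply/IHs; exists p.
Qed.

End Zip.

Section HoleArcs.
Variable T : diagram.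
Hypothesis HT : is_tangle T.
Let T_surface := tangle_surface HT.
Implicit Types b c : side T.

(** A vertex of degree zero is alone on its hole. *)
Lemma degree_hole b c : bdry b -> c \in hole b -> (degree c == 0) = (degree b == 0).
Proof.
move=> bb; rewrite /hole -fconnect_orbit => bc.
have cc : bdry c by rewrite -(iter_findex bc) (bdry_iter_bnext T_surface).
have fix_iter d n : bnext d = d -> iter n (@bnext T) d = d.
  by move=> E; elim: n => //= n ->.
apply/eqP/eqP=> d0; last first.
  by rewrite -(iter_findex bc) fix_iter // (is_tangle_degree0_bnext HT).
have cb : fconnect (@bnext T) c b by rewrite fconnect_sym //; apply: bnext_inj T_surface.
by rewrite -(iter_findex cb) fix_iter // (is_tangle_degree0_bnext HT).
Qed.

(** The number of endpoints on a hole determines its number of arcs, as a hole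
    disjoint from the tangle is a single side. *)
Lemma order_bnext b : bdry b -> order (@bnext T) b = maxn 1 (endpoints b).
Proof.
move=> bb; have h1 : 0 < order (@bnext T) b by apply: order_gt0.
have [d0|d1] := boolP (degree b == 0).
  have := endpoints_eq0 HT bb; rewrite d0 => /eqP->.
  by case: (degree_bdry HT bb) => [|[_]]; rewrite ?(eqP d0) // /hole size_orbit.
suff -> : endpoints b = order (@bnext T) b by rewrite (maxn_idPr h1).
rewrite -(size_orbit (@bnext T)) -/(hole b) /endpoints; apply/eqP.
rewrite -all_count; apply/allP=> c cb; move: d1; rewrite -(degree_hole bb cb).
by case: (degree_bdry HT (allP (hole_bdry T_surface bb) c cb)) => [->|[->]].
Qed.

(* The sides of a lower hole, in the order in which [lower_arcs] lists them. *)
Definition reversed_hole b : seq (side T) := b :: rev (behead (hole b)).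

Lemma perm_reversed_hole b : perm_eq (reversed_hole b) (hole b).
Proof.
rewrite /reversed_hole /hole /orbit.
by have := order_gt0 (@bnext T) b; case: order => //= n _; rewrite perm_cons perm_rev.
Qed.

Lemma nth_reversed_hole b i : i < order (@bnext T) b ->
  nth b (reversed_hole b) i = iter (order (@bnext T) b - i) (@bnext T) b.
Proof.
case: i => [|i] io; first by rewrite subn0 iter_order //; apply: bnext_inj T_surface.
rewrite /= nth_rev size_behead /hole size_orbit; last by rewrite -ltnS prednK ?order_gt0.
rewrite nth_behead /orbit -subSn; last by rewrite -ltnS prednK ?order_gt0.
by rewrite prednK ?order_gt0 // nth_traject //; lia.
Qed.

Lemma nth_hole b i : i < order (@bnext T) b -> nth b (hole b) i = iter i (@bnext T) b.
Proof. by move=> io; rewrite /hole /orbit nth_traject. Qed.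

End HoleArcs.

Lemma size_reversed_hole (T : diagram) (b : side T) :
  size (reversed_hole b) = order (@bnext T) b.
Proof. by rewrite (perm_size (perm_reversed_hole b)) /hole size_orbit. Qed.

(** Sides with opposite ranks from the starting points, i being the rank on the
    upper side; the starting sides correspond both to i = 0 and to the order. *)
Lemma zip_holesP (T T' : diagram) (b : side T) (b' : side T') a a' :
    is_tangle T -> is_tangle T' -> order (@bnext T) b = order (@bnext T') b' ->
  (a, a') \in zip (reversed_hole b) (hole b') <->
  exists2 i, i <= order (@bnext T) b &
    a = iter (order (@bnext T) b - i) (@bnext T) b /\ a' = iter i (@bnext T') b'.
Proof.
move=> HT HT' oE; have o0 := order_gt0 (@bnext T) b.
have sz : size (reversed_hole b) = size (hole b').
  by rewrite size_reversed_hole /hole size_orbit.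
have nthE i : i < order (@bnext T) b -> nth (b, b') (zip (reversed_hole b) (hole b')) i =
    (iter (order (@bnext T) b - i) (@bnext T) b, iter i (@bnext T') b').
  by move=> io; rewrite nth_zip // (nth_reversed_hole HT) // nth_hole // -oE.
have szz : size (zip (reversed_hole b) (hole b')) = order (@bnext T) b.
  by rewrite size1_zip ?sz // -sz size_reversed_hole.
split=> [/(nthP (b, b'))[i]|[i io [-> ->]]].
  by rewrite szz => io; rewrite nthE // => -[<- <-]; exists i => //; apply: ltnW.
case: (ltngtP i (order (@bnext T) b)) io => // [io _|-> _].
  by rewrite -nthE // mem_nth ?szz.
rewrite subnn oE iter_order; last exact: bnext_inj (tangle_surface HT').
have := mem_nth (b, b') (_ : 0 < size (zip (reversed_hole b) (hole b'))).
rewrite szz nthE // subn0 iter_order; last exact: bnext_inj (tangle_surface HT).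
exact.
Qed.

Section Paste.
Variables T T' : diagram.
Hypotheses (HT : is_tangle T) (HT' : is_tangle T') (TT' : matches T T').
Let T_surface := tangle_surface HT.
Let T'_surface := tangle_surface HT'.
Let P := paste T T'.
Let jl : side T -> side P := inl.
Let jr : side T' -> side P := inr.
Let Z := zip (lower_arcs T) (upper_arcs T').

Lemma all_bdry_arcs (Q : diagram) (l : seq (side Q)) : is_tangle Q ->
  all (@bdry Q) l -> all (@bdry Q) (flatten (map (@hole Q) l)).
Proof.
move=> HQ; elim: l => //= b l IHl /andP[bb bl]; rewrite all_cat IHl // andbT.
exact: (hole_bdry (tangle_surface HQ)).
Qed.

Lemma perm_lower_arcs (Q : diagram) :
  perm_eq (lower_arcs Q) (flatten (map (@hole Q) (lower Q))).
Proof.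
rewrite /lower_arcs; elim: (lower Q) => // b l IHl.
exact: (perm_cat (perm_reversed_hole b) IHl).
Qed.

Lemma arcs_uniq (Q : diagram) : is_tangle Q -> uniq (upper_arcs Q ++ lower_arcs Q).
Proof.
move=> HQ; have := decorated_uniq HQ; rewrite map_cat flatten_cat => u.
have E : perm_eq (upper_arcs Q ++ lower_arcs Q)
    (upper_arcs Q ++ flatten (map (@hole Q) (lower Q))).
  by rewrite perm_cat2l perm_lower_arcs.
by rewrite (perm_uniq E).
Qed.

Lemma arcs_bdry (Q : diagram) : is_tangle Q ->
  all (@bdry Q) (upper_arcs Q) /\ all (@bdry Q) (lower_arcs Q).
Proof.
move=> HQ; have := decorated_bdry HQ; rewrite all_cat => /andP[ub lb].
by rewrite (perm_all _ (perm_lower_arcs Q)) !all_bdry_arcs.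
Qed.

Let size_holes : size (lower T) = size (upper T').
Proof. by have := congr1 size TT'; rewrite !size_map. Qed.

Let paired_holes p : p \in zip (lower T) (upper T') ->
  [/\ bdry p.1, bdry p.2, endpoints p.1 = endpoints p.2 &
      order (@bnext T) p.1 = order (@bnext T') p.2].
Proof.
case: p => b b' bb' /=; have [bl bu] := zip_mem bb'.
have bb : bdry b by apply: (allP (decorated_bdry HT)); rewrite mem_cat bl orbT.
have bb'' : bdry b' by apply: (allP (decorated_bdry HT')); rewrite mem_cat bu.
have eE : endpoints b = endpoints b'.
  have := TT'; rewrite /matches => /eqP; rewrite eq_map_zip //.
  by move=> /allP/(_ _ bb')/eqP.
by rewrite !order_bnext // eE.
Qed.

Let size_paired p : p \in zip (lower T) (upper T') ->
  size (reversed_hole p.1) = size (hole p.2).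
Proof.
by move=> /paired_holes[_ _ _ oE]; rewrite size_reversed_hole oE /hole size_orbit.
Qed.

Lemma size_arcs : size (lower_arcs T) = size (upper_arcs T').
Proof. exact: size_flatten_zip size_holes size_paired. Qed.

Lemma paired_arcsP a a' : (a, a') \in Z <->
  exists2 p, p \in zip (lower T) (upper T') &
  exists2 i, i <= order (@bnext T) p.1 &
    a = iter (order (@bnext T) p.1 - i) (@bnext T) p.1 /\
    a' = iter i (@bnext T') p.2.
Proof.
rewrite /Z /lower_arcs /upper_arcs.
have fP := zip_flattenP a a' size_holes size_paired.
split=> [/fP[p pz aa']|[p pz ai]]; [exists p => //|apply/fP; exists p => //];
  have [_ _ _ oE] := paired_holes pz; exact/(zip_holesP _ _ HT HT' oE).
Qed.

Let lower_uniq : uniq (lower_arcs T).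
Proof. by have := arcs_uniq HT; rewrite cat_uniq => /and3P[]. Qed.

Let upper_uniq : uniq (upper_arcs T').
Proof. by have := arcs_uniq HT'; rewrite cat_uniq => /and3P[]. Qed.

Let opp_jl a : opp (jl a) =
  if partner (lower_arcs T) (upper_arcs T') a is Some c then jr c else jl (opp a).
Proof. by []. Qed.

Let opp_jr a : opp (jr a) =
  if partner (upper_arcs T') (lower_arcs T) a is Some c then jl c else jr (opp a).
Proof. by []. Qed.

Lemma opp_paste_left a (a' : side T') : opp (jl a) = jr a' <-> (a, a') \in Z.
Proof.
rewrite -(partnerP _ _ lower_uniq size_arcs).
rewrite opp_jl.
by case: partner => [c|]; split=> // -[->].
Qed.

Lemma opp_paste_right a (a' : side T') : opp (jr a') = jl a <-> (a, a') \in Z.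
Proof.
rewrite /Z zip_memC -(partnerP _ _ upper_uniq (esym size_arcs)).
rewrite opp_jr.
by case: partner => [c|]; split=> // -[->].
Qed.

Let paired_bdry a a' : (a, a') \in Z -> bdry a /\ bdry a'.
Proof.
case/zip_mem => al au; split.
  exact: (allP (arcs_bdry HT).2).
exact: (allP (arcs_bdry HT').1).
Qed.

Let paired_degree a a' : (a, a') \in Z -> (degree a == 0) = (degree a' == 0).
Proof.
case/paired_arcsP=> p /paired_holes[bb bb' eE _] [i _ [-> ->]].
rewrite (degree_hole HT bb) ?(degree_hole HT' bb') -?endpoints_eq0 ?eE //;
  by rewrite /hole -fconnect_orbit fconnect_iter.
Qed.

Let paired_bnext_left a a' : (a, a') \in Z ->
  exists2 c', (bnext a, c') \in Z & bnext c' = a'.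
Proof.
case/paired_arcsP=> -[b b'] pz [i io [-> ->]]; have [bb bb' _ oE] := paired_holes pz.
rewrite /= in io oE *; have o0 := order_gt0 (@bnext T) b.
have fo := iter_order (bnext_inj T_surface) b.
have fo' := iter_order (bnext_inj T'_surface) b'.
case: i io => [|i] io.
  exists (iter (order (@bnext T) b).-1 (@bnext T') b'); last first.
    by rewrite -iterS prednK // oE fo'.
  apply/paired_arcsP; exists (b, b') => //; exists (order (@bnext T) b).-1 => /=.
    by lia.
  by rewrite subn0 fo (_ : _ - _ = 1) //; lia.
exists (iter i (@bnext T') b') => //; apply/paired_arcsP.
exists (b, b') => //; exists i => /=; first exact: ltnW.
by rewrite -iterS -subSn // subSS.
Qed.

Let paired_bnext_right a a' : (a, a') \in Z ->
  exists2 c, (c, bnext a') \in Z & bnext c = a.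
Proof.
case/paired_arcsP=> -[b b'] pz [i io [-> ->]]; have [bb bb' _ oE] := paired_holes pz.
rewrite /= in io oE *; have o0 := order_gt0 (@bnext T) b.
have fo := iter_order (bnext_inj T_surface) b.
have fo' := iter_order (bnext_inj T'_surface) b'.
case: (ltngtP i (order (@bnext T) b)) io => // [io _|-> _].
  exists (iter (order (@bnext T) b - i.+1) (@bnext T) b).
    by apply/paired_arcsP; exists (b, b') => //; exists i.+1.
  by rewrite -iterS -subSn // subSS.
exists (iter (order (@bnext T) b).-1 (@bnext T) b); last first.
  by rewrite -iterS prednK // fo subnn.
apply/paired_arcsP; exists (b, b') => //; exists 1 => //=.
by split; [rewrite subn1 | rewrite oE fo'].
Qed.

(** Ranks on matching holes run in opposite directions, as do [bnext] and the
    inverse of [bnext]. *)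
Lemma paste_pasting : pasting jl jr.
Proof.
split; last by case=> a; [left|right]; exists a.
  split=> //; first by move=> a b [].
  - move=> a; rewrite opp_jl.
    by case: partner => [c|]; [right; exists c | left].
  - by move=> a a' /opp_paste_left Zaa'; have [ba _] := paired_bdry Zaa';
      split=> //; apply/opp_paste_right.
  - move=> a a' /opp_paste_left/paired_bnext_left[c' Zc <-].
    by exists c' => //; apply/opp_paste_left.
  by move=> a a' /opp_paste_left/paired_degree.
split=> //; first by move=> a b [].
- move=> a; rewrite opp_jr.
  by case: partner => [c|]; [right; exists c | left].
- by move=> a' a /opp_paste_right Zaa'; have [_ ba] := paired_bdry Zaa';
    split=> //; apply/opp_paste_left.
- move=> a' a /opp_paste_right/paired_bnext_right[c Zc <-].
  by exists c => //; apply/opp_paste_right.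
by move=> a' a /opp_paste_right/paired_degree.
Qed.

Lemma upper_unglued :
  {in upper_arcs T, forall a, bdry a && ~~ glued jl jr a}.
Proof.
move=> a au; rewrite (allP (arcs_bdry HT).1) //; apply/negP=> /gluedP[a'].
move=> /opp_paste_left/zip_mem[al _].
have := arcs_uniq HT; rewrite cat_uniq => /and3P[_ /hasPn/(_ a al)].
by rewrite /= au.
Qed.

Lemma lower_unglued :
  {in lower_arcs T', forall a, bdry a && ~~ glued jr jl a}.
Proof.
move=> a al; rewrite (allP (arcs_bdry HT').2) //; apply/negP=> /gluedP[c].
move=> /opp_paste_right/zip_mem[_ au].
have := arcs_uniq HT'; rewrite cat_uniq => /and3P[_ /hasPn/(_ a al)].
by rewrite /= au.
Qed.

Lemma upper_arcs_paste : upper_arcs P = map jl (upper_arcs T).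
Proof.
rewrite /upper_arcs map_flatten -!map_comp; congr flatten.
apply/eq_in_map => b bu /=; have /andP[bb nb] : bdry b && ~~ glued jl jr b.
  apply: upper_unglued; apply/flattenP; exists (hole b); first exact: map_f.
  exact: in_orbit.
exact: (hole_pasted HT HT' paste_pasting).
Qed.

Lemma lower_arcs_paste : lower_arcs P = map jr (lower_arcs T').
Proof.
rewrite /lower_arcs map_flatten -!map_comp; congr flatten.
apply/eq_in_map => b bl /=; have /andP[bb nb] : bdry b && ~~ glued jr jl b.
  apply: lower_unglued; apply/flattenP; exists (reversed_hole b); first exact: map_f.
  exact: mem_head.
rewrite -[inr b]/(jr b) (hole_pasted HT' HT (pasting_sym paste_pasting)) //.
by rewrite behead_map map_rev.
Qed.

Lemma agree_paste (A : eqType) (s : {ffun face T -> A}) (s' : {ffun face T' -> A}) :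
  agree jl jr s s' =
  ([seq s (face_of a) | a <- lower_arcs T] == [seq s' (face_of a) | a <- upper_arcs T']).
Proof.
rewrite (eq_map_zip _ _ size_arcs); apply/agreeP/allP=> [agr [a a']|all_eq a a'].
  by move=> /opp_paste_left/agr E; apply/eqP.
by move=> /opp_paste_left/all_eq/eqP.
Qed.

End Paste.

Theorem theorem3p1 (R Rs : comUnitRingType) (W : weights R Rs)
    (T T' : diagram) :
  is_tangle T -> is_tangle T' ->
  well_placed T -> well_placed T' ->
  matches T T' ->
  evaluation W (paste T T') = mul_indexed (evaluation W T') (evaluation W T).
Proof.
move=> HT HT' wp wp' TT'.
apply: (evaluation_pasted HT HT' (paste_pasting HT HT' TT') wp wp').
- exact: upper_arcs_paste.
- exact: lower_arcs_paste.
- exact: upper_unglued.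
- exact: lower_unglued.
by move=> s s'; apply: agree_paste.
Qed.
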